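(* Let $r>2$ be an integer. There exists a constant $A_r>0$ depending only on $r$ such that for every $\beta>0$ there exists $C>0$ such that for $p=p(n)\ge\frac Cn$, with high probability $G(n,p)\to_r\mathcal C$, where $\mathcal C=\{C_t\mid A_r\log n\le t\le(\frac1{r2^{r+4}}-\beta)n,\ t\text{ is odd}\}$. In particular, with high probability $G(n,p)\to_rC_{\lfloor(\frac1{r2^{r+4}}-\beta)n\rfloor_{odd}}$.
   Context: $G(n,p)$ is the binomial random graph on $\{1,\dots,n\}$ with each pair an edge independently with probability $p$. ''With high probability'' means with probability tending to $1$ as $n\to\infty$. $C_t$ is the cycle of length $t$ (with $t$ edges); $\log$ is the natural logarithm. $\lfloor\ell\rfloor_{odd}$ is the largest odd integer $m\le\ell$. For graphs $G,H$, $G\to_rH$ means that every $r$-coloring of the edges of $G$ contains a monochromatic copy of $H$. For a family $\mathcal H$ of graphs, $G\to_r\mathcal H$ means that for every $r$-coloring of the edges of $G$ there exists a color $i$ such that there is a monochromatic copy of every $H\in\mathcal H$ in color $i$. The number $\beta$ in the ''in particular'' part is understood to be small enough that the cycle length is meaningful ($\beta<\frac1{r2^{r+4}}$). *)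

(* Defs.v *)
From HB Require Import structures.
From mathcomp Require Import all_boot all_order all_algebra.
From mathcomp Require Import all_classical all_reals all_analysis.

Set Implicit Arguments.
Unset Strict Implicit.
Unset Printing Implicit Defensive.

Import Order.TTheory GRing.Theory Num.Theory.
Import numFieldNormedType.Exports.

Local Open Scope classical_set_scope.
Local Open Scope ring_scope.

Record sgraph := SGraph {
  vertex :> finType;
  adj : rel vertex;
  adj_sym : symmetric adj;
  adj_irr : irreflexive adj }.

(* For t >= 3 this is the cycle with t edges; the conjunct i != j only
   excludes the loop that would appear for t = 1. *)
Definition cycle_adj (t : nat) : rel 'I_t :=
  fun i j => (i != j) && ((j == ordS i) || (i == ordS j)).

Lemma cycle_adj_sym t : symmetric (@cycle_adj t).
Proof. by move=> i j; rewrite /cycle_adj eq_sym orbC. Qed.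

Lemma cycle_adj_irr t : irreflexive (@cycle_adj t).
Proof. by move=> i; rewrite /cycle_adj eqxx. Qed.

Definition cycle_graph (t : nat) : sgraph :=
  SGraph (@cycle_adj_sym t) (@cycle_adj_irr t).

(* Colorings are total on {set G}; only the values on edges [set x; y] of G are
   ever used, so for r > 0 this amounts to quantifying over edge colorings. *)
Definition coloring (r : nat) (G : sgraph) := {set G} -> 'I_r.

Definition mono_copy (r : nat) (G H : sgraph) (c : coloring r G) (i : 'I_r) :=
  exists f : H -> G, injective f /\
    forall x y : H, adj x y -> adj (f x) (f y) /\ c [set f x; f y]%SET = i.

Definition arrow (r : nat) (G H : sgraph) : Prop :=
  forall c : coloring r G, exists i : 'I_r, mono_copy H c i.

(* The family is {H a | a \in D}. *)
Definition arrow_family (r : nat) (G : sgraph) (I : Type) (D : set I)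
    (H : I -> sgraph) : Prop :=
  forall c : coloring r G, exists i : 'I_r,
    forall a, D a -> mono_copy (H a) c i.

Definition pairs (n : nat) : {set {set 'I_n}} :=
  [set e : {set 'I_n} | #|e| == 2]%SET.

Definition edges_adj (n : nat) (E : {set {set 'I_n}}) : rel 'I_n :=
  fun x y => (x != y) && ([set x; y]%SET \in E).

Lemma edges_adj_sym n (E : {set {set 'I_n}}) : symmetric (edges_adj E).
Proof. by move=> x y; rewrite /edges_adj eq_sym finset.setUC. Qed.

Lemma edges_adj_irr n (E : {set {set 'I_n}}) : irreflexive (edges_adj E).
Proof. by move=> x; rewrite /edges_adj eqxx. Qed.

Definition graph_of_edges (n : nat) (E : {set {set 'I_n}}) : sgraph :=
  SGraph (edges_adj_sym E) (edges_adj_irr E).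

(* The product law on edge sets: every pair is present with probability p,
   independently of the others. *)
Definition gnp_weight (R : realType) (n : nat) (p : R) (E : {set {set 'I_n}}) : R :=
  \prod_(e in pairs n) (if e \in E then p else 1 - p).

Definition gnp_prob (R : realType) (n : nat) (p : R) (P : sgraph -> Prop) : R :=
  \sum_(E in powerset (pairs n) | `[< P (graph_of_edges E) >]) gnp_weight p E.

Definition whp (R : realType) (p : nat -> R) (P : nat -> sgraph -> Prop) : Prop :=
  gnp_prob n (p n) (P n) @[n --> \oo] --> (1 : R).

Lemma gnp_probT (R : realType) (n : nat) (p : R) : gnp_prob n p (fun=> True) = 1.
Proof.
have <- : \prod_(e : {set 'I_n}) ((if e \in pairs n then p else 0)
    + (if e \in pairs n then 1 - p else 1)) = 1 :> R.
  rewrite big1 // => e _.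
  by case: (e \in pairs n); rewrite ?add0r // addrCA subrr addr0.
rewrite bigA_distr [RHS](bigID (fun E => E \in powerset (pairs n))) /=.
rewrite [X in _ = _ + X]big1 ?addr0 => [|E]; last first.
  rewrite powersetE => /fintype.subsetPn[e eE /negbTE ep].
  by rewrite (bigD1 e) //= eE ep mul0r.
apply: eq_big => [E|E]; first by rewrite (asboolT I) andbT.
rewrite powersetE => /andP[/fintype.subsetP sE _].
rewrite /gnp_weight big_mkcond; apply: eq_bigr => e _.
by have [|/negbTE ep] := boolP (e \in pairs n); case: ifPn => // /sE; rewrite ep.
Qed.

(* For x < 1 there is no odd natural number below x and the value is 0. *)
Definition floor_odd (R : realType) (x : R) : nat := \max_(m < (Num.truncn x).+1 | odd m) m.

Lemma floor_oddP (R : realType) (x : R) : 1 <= x ->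
  [/\ odd (floor_odd x), (floor_odd x)%:R <= x &
      forall m, odd m -> m%:R <= x -> (m <= floor_odd x)%N].
Proof.
move=> x1; have x0 : 0 <= x by apply: le_trans x1.
have H m : m%:R <= x -> (m < (Num.truncn x).+1)%N.
  by rewrite ltnS truncn_ge_nat.
have m1 := H 1%N x1.
have [i oi ei] : {i : 'I_(Num.truncn x).+1 | odd i & floor_odd x = i}.
  by apply: eq_bigmax_cond; apply/card_gt0P; exists (Ordinal m1).
split; first by rewrite ei.
- by rewrite ei -truncn_ge_nat // -ltnS ltn_ord.
- by move=> m om mx; exact: (leq_bigmax_cond (Ordinal (H m mx))).
Qed.

(* Main.v *)
(** With high probability any two disjoint sets of at least n/E vertices are joined
    by an edge, for a large constant E depending on r; nothing else about G(n,p)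
    is used, and the colour found contains cycles of all lengths in the range.

    Partition the vertices into boundedly many cells such that, apart from few
    pairs of cells, each colour on a pair is either absent or "joined": it has an
    edge between any two parts of the cells of size at least s, a small constant
    fraction of a cell.  As in the regularity lemma, such a partition comes from
    iterated refinement, the potential being the number of vertex pairs lying in
    pairs of cells that miss a colour.

    Fix a colour and keep only its edges inside joined pairs of cells.  Remove
    repeatedly a set A of at most K vertices together with its neighbourhood when
    the latter is no larger than A: this retains half of the vertices removed, in
    pieces of size at most K without edges to the rest.  When it stops, either the
    reduced graph on the cells has a bipartite component, and its larger class is
    retained, or there is a nonbipartite component in which depth-first search
    yields a path on any number of vertices up to about K.  Such a path is closed
    to a cycle of any prescribed length by two binary trees, one at each end and
    both of the same depth about log n, that walk through the bipartite double
    cover of the reduced graph towards one fixed edge of it; the double cover is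
    connected, so both parities are available at every cell.

    If every colour misses some length, r such steps leave about n/2^r vertices,
    and these carry one partition per colour into pieces of size at most K.  As r K
    is much smaller than n/2^r, there are two linear-size sets inside a good pair
    of cells which are separated by all these partitions.  No colour can then be
    joined on that pair, so all colours are absent, which is a contradiction. *)
From mathcomp Require Import all_boot zify.

Set Implicit Arguments.
Unset Strict Implicit.
Unset Printing Implicit Defensive.

(** * Trees and depth-first search *)

Lemma subset_of_card (T : finType) (A : {set T}) (k : nat) :
  k <= #|A| -> exists2 B : {set T}, B \subset A & #|B| = k.
Proof.
move=> kA; exists [set x in take k (enum A)].
  by apply/subsetP => x; rewrite inE => /mem_take; rewrite mem_enum.
rewrite cardsE; have /card_uniqP -> : uniq (take k (enum A)).
  exact/take_uniq/enum_uniq.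
by rewrite size_take -cardE; case: ltnP => // ?; apply/eqP; rewrite eqn_leq kA andbT.
Qed.

Lemma leq_card_bigcup (V J : finType) (F : J -> {set V}) (c : nat) :
  (forall j, #|F j| <= c) -> #|\bigcup_j F j| <= #|J| * c.
Proof.
move=> Fc; rewrite -sum_nat_const.
elim/big_ind2: _ => [|A x B y Ax By|j _]; first by rewrite cards0.
  by apply: leq_trans (leq_card_setU _ _) (leq_add Ax By).
exact: Fc.
Qed.

Section Graphs.

Variables (V : finType) (e : rel V).

Definition nbh (A : {set V}) := [set y | [exists x in A, e x y]].

Definition nbrs (U A : {set V}) := (U :\: A) :&: nbh A.

Definition no_edges (A B : {set V}) :=
  forall x y, x \in A -> y \in B -> ~~ e x y.

(** Plays the role of a dense regular pair. It holds vacuously when one side has fewer than [s]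
    vertices. *)
Definition joined (s : nat) (A B : {set V}) :=
  [forall X : {set V}, forall Y : {set V},
    [&& X \subset A, Y \subset B, s <= #|X| & s <= #|Y|] ==>
    [exists x in X, exists y in Y, e x y]].

Lemma joinedP (s : nat) (A B : {set V}) :
  reflect (forall X Y : {set V}, X \subset A -> Y \subset B ->
             s <= #|X| -> s <= #|Y| ->
             exists x y, [/\ x \in X, y \in Y & e x y])
          (joined s A B).
Proof.
apply: (iffP forallP) => [H X Y XA YB sX sY|H X].
  have /forallP/(_ Y)/implyP := H X; rewrite XA YB sX sY => /(_ isT).
  by case/exists_inP => x xX /exists_inP[y yY exy]; exists x, y.
apply/forallP => Y; apply/implyP => /and4P[XA YB sX sY].
have [x [y [xX yY exy]]] := H X Y XA YB sX sY.
by apply/exists_inP; exists x => //; apply/exists_inP; exists y.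
Qed.

Lemma joined_sym (s : nat) (A B : {set V}) :
  symmetric e -> joined s A B = joined s B A.
Proof.
move=> es; have H : forall C D, joined s C D -> joined s D C.
  move=> C D /joinedP CD; apply/joinedP => X Y XD YC sX sY.
  have [x [y [? ? ?]]] := CD _ _ YC XD sY sX.
  by exists y, x; split=> //; rewrite es.
by apply/idP/idP; apply: H.
Qed.

(* Depth-first search: S is the set of exhausted vertices, p the current path;
   |S| grows by one at a time, so every prescribed size is met. *)
Lemma dfs_separation (W : {set V}) (m k : nat) :
  (forall x p, path e x p -> uniq (x :: p) -> {subset x :: p <= W} ->
     size p < m) ->
  symmetric e -> k <= #|W| ->
  exists S : {set V}, [/\ S \subset W, #|S| = k & #|nbrs W S| <= m].
Proof.
move=> short es kW.
suff [S [p [SW cS sp Sp [up pp]]]] : exists (S : {set V}) (p : seq V),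
    [/\ S \subset W, #|S| = k, {subset p <= W :\: S},
        (forall x y, x \in S -> y \in W :\: S -> e x y -> y \in p) &
      uniq p /\ sorted e p].
  exists S; split=> //; apply: (@leq_trans (size p)).
    rewrite cardE; apply: uniq_leq_size (enum_uniq _) _ => y.
    by rewrite mem_enum in_setI [y \in nbh S]in_set => /andP[yW /exists_inP[x xS /Sp]]; apply.
  case: p {Sp} sp up pp => [//|x p] sp up pp.
  by apply: short pp up _ => y /sp; rewrite inE => /andP[].
elim: k kW => [|k IH] kW.
  exists set0, [::]; split=> //; first exact: sub0set.
    by rewrite cards0.
  by move=> x y; rewrite inE.
have [S0 [p0 [SW cS sp Sp [up pp]]]] := IH (ltnW kW).
(* While [S0] is fixed the path grows at its head, at most to the size of [W]; once it is stuck, the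
   head is exhausted and joins [S0]. *)
have [d] := ubnP (#|W| - size p0).
elim: d p0 sp Sp up pp => // d IHd [|x p] sp Sp up pp dlt.
  have [y] : exists y, y \in W :\: S0.
    by apply/set0Pn; rewrite -card_gt0 cardsD (setIidPr SW) cS subn_gt0.
  move=> yWS; apply: (IHd [:: y]) => //.
  - by move=> z; rewrite inE => /eqP->.
  - by move=> u v uS vW /(Sp _ _ uS vW).
  - by move: dlt kW => /=; lia.
have [/exists_inP[y yW exy]|/exists_inPn H] :=
    boolP [exists y in W :\: S0 :\: [set z in x :: p], e x y].
  move: yW; rewrite in_setD in_set => /andP[yp yWS].
  apply: (IHd [:: y, x & p]) => //.
  - by move=> z; rewrite inE => /predU1P[->|/sp].
  - by move=> u v uS vW /(Sp _ _ uS vW) vp; rewrite inE vp orbT.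
  - by rewrite cons_uniq yp.
  - by rewrite /= es exy.
  - have : uniq [:: y, x & p] by rewrite cons_uniq yp.
    move/card_uniqP => cyp.
    have : size [:: y, x & p] <= #|W|.
      rewrite -cyp; apply/subset_leq_card/subsetP => z.
      rewrite inE => /predU1P[->|/sp]; first by case/setDP: yWS.
      by case/setDP.
    by move: dlt => /=; lia.
have /setDP[xW xS] : x \in W :\: S0 by apply: sp; rewrite mem_head.
move: up => /= /andP[xp up].
exists (x |: S0), p; split=> //.
- by apply/subsetP => z /setU1P[->|/(subsetP SW)].
- by rewrite cardsU1 xS cS.
- move=> z zp; rewrite !inE negb_or.
  have /setDP[zW zS] : z \in W :\: S0 by apply: sp; rewrite inE zp orbT.
  by rewrite zS zW !andbT; apply: contraNneq xp => <-.
- move=> u v /setU1P[->|uS]; rewrite !inE negb_or => /andP[/andP[vx vS] vW].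
    move=> exv; apply/idPn => vp.
    have := H v; rewrite !inE negb_or vx vp vS vW => /(_ isT).
    by rewrite exv.
  by move=> /(Sp u v uS); rewrite !inE vS vW (negPf vx) => /(_ isT).
- by split=> //; apply: path_sorted pp.
Qed.

Variables (N : finType) (S : N -> {set V}) (nx : N -> N) (D : {set N}) (s : nat).

Lemma nbhU (A B : {set V}) : nbh (A :|: B) = nbh A :|: nbh B.
Proof.
apply/setP => y; rewrite !inE; apply/exists_inP/orP => [[x]|].
  by rewrite inE => /orP[xA|xB] exy; [left|right]; apply/exists_inP; exists x.
by case=> /exists_inP[x xA exy]; exists x => //; rewrite inE xA ?orbT.
Qed.

(* Remove from each S v a largest family of badly expanding sets: joinedness
   keeps what is removed below s, and maximality makes the rest expand. *)
Lemma expanding_core :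
  0 < s -> {in D, forall v, nx v \in D} -> {in D, forall v, 14 * s <= #|S v|} ->
  {in D, forall v, joined s (S v) (S (nx v))} ->
  exists C : N -> {set V},
    [/\ forall v, C v \subset S v,
        forall v, #|S v| <= #|C v| + s &
        {in D, forall v (A : {set V}), A \subset C v -> #|A| <= 2 * s ->
           4 * #|A| <= #|C (nx v) :&: nbh A|}].
Proof.
move=> s0 nxD big Sj.
pose C (B : {ffun N -> {set V}}) v := S v :\: B v.
pose P (B : {ffun N -> {set V}}) := [forall v, [&& B v \subset S v, #|B v| <= s &
   #|C B (nx v) :&: nbh (B v)| <= 4 * #|B v| ]].
pose B0 : {ffun N -> {set V}} := [ffun=> set0].
have PB0 : P B0.
  apply/forallP => v; rewrite ffunE sub0set cards0 /= leqn0 cards_eq0.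
  apply/eqP/setP => y; rewrite !inE; apply/negP => /andP[_ /exists_inP[x]].
  by rewrite inE.
case: (@arg_maxnP _ B0 P (fun B : {ffun N -> {set V}} => \sum_v #|B v|) PB0).
move=> B /forallP PB maxB.
exists (C B); split=> [v|v|v vD A AC cA]; first exact: subsetDl.
  have /and3P[BS Bs _] := PB v.
  by rewrite -(cardsID (B v) (S v)) addnC leq_add2l (setIidPr BS).
have /and3P[BS Bs nB] := PB v.
have [AS AB] : A \subset S v /\ [disjoint A & B v].
  by move: AC; rewrite subsetD => /andP[].
rewrite leqNgt; apply/negP => small.
have A0 : 0 < #|A| by case: #|A| small; rewrite ?muln0.
have cBA : #|B v :|: A| = #|B v| + #|A|.
  by rewrite cardsU disjoint_setI0 1?disjoint_sym // cards0 subn0.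
have nBA : #|C B (nx v) :&: nbh (B v :|: A)| <= 4 * #|B v :|: A|.
  rewrite nbhU setIUr cBA mulnDr; apply: leq_trans (leq_card_setU _ _) _.
  by apply: leq_add => //; apply: ltnW.
have BAS : B v :|: A \subset S v by rewrite subUset BS.
have [BAs|sBA] := leqP #|B v :|: A| s.
  pose B' : {ffun N -> {set V}} := [ffun w => if w == v then B v :|: A else B w].
  have BB' w : B w \subset B' w.
    by rewrite ffunE; case: eqP => [->|_] //; apply: subsetUl.
  have PB' : P B'.
    apply/forallP => w; have /and3P[BSw Bsw nBw] := PB w.
    have mon : C B' (nx w) \subset C B (nx w) by apply/setDS/BB'.
    rewrite [B' w]ffunE; case: (altP (w =P v)) mon => [->|wv] mon.
      rewrite BAS BAs; apply: leq_trans nBA.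
      by apply/subset_leq_card/setSI.
    rewrite BSw Bsw; apply: leq_trans nBw.
    by apply/subset_leq_card/setSI.
  have := maxB _ PB'.
  rewrite (bigD1 v) //= [in X in _ >= X](bigD1 v) //= [B' v]ffunE eqxx cBA.
  rewrite [X in _ >= _ + _ + X](eq_bigr (fun w => #|B w|)).
    by rewrite leq_add2r -[X in _ <= X]addn0 leq_add2l leqNgt A0.
  by move=> w wv; rewrite ffunE (negPf wv).
(* Now [B v :|: A] has between s and 3s vertices and hence at most 12s neighbours in [C B (nx v)].
   At least s vertices of that set are left over, against joinedness. *)
have cC : 13 * s <= #|C B (nx v)|.
  have /and3P[BSn Bsn _] := PB (nx v).
  by rewrite cardsD (setIidPr BSn); have := big _ (nxD _ vD); lia.
have /joinedP/(_ _ (C B (nx v) :\: nbh (B v :|: A)) BAS) := Sj v vD.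
case=> [||//|x [y [xBA /setDP[_ /negP yN] exy]]].
- by apply: subset_trans (subsetDl _ _) (subsetDl _ _).
- exact: ltnW.
- rewrite cardsD; apply: leq_trans (leq_sub cC nBA).
  by have := leq_trans (leq_add Bs cA) (leqnn _); rewrite -cBA; lia.
- by apply: yN; rewrite inE; apply/exists_inP; exists x.
Qed.

(* The layers have exactly 2 ^ j vertices, so the depth d is the same for all
   roots and all walks v, nx v, nx (nx v), ... *)
Lemma exact_depth_tree (C : N -> {set V}) (d : nat) (v : N) (u : V) :
  {in D, forall v, nx v \in D} ->
  {in D, forall v (A : {set V}), A \subset C v -> #|A| <= 2 * s ->
     4 * #|A| <= #|C (nx v) :&: nbh A|} ->
  2 ^ d < 4 * s -> v \in D -> u \in C v ->
  exists A : {set V}, [/\ A \subset C (iter d nx v), #|A| = 2 ^ d &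
    forall w, w \in A -> exists p, [/\ path e u p, last u p = w, size p = d,
      uniq (u :: p) & forall x, x \in u :: p -> exists2 v', v' \in D & x \in C v']].
Proof.
move=> nxD expC ds vD uC.
suff [A [Z [AC cA cZ Zp]]] : exists (A Z : {set V}),
   [/\ A \subset C (iter d nx v), #|A| = 2 ^ d, #|Z| < 2 ^ d.+1 &
    A \subset Z /\
    forall w, w \in A -> exists p, [/\ path e u p, last u p = w, size p = d,
      uniq (u :: p) & {subset u :: p <= Z} /\
        forall x, x \in u :: p -> exists2 v', v' \in D & x \in C v']].
  exists A; split=> // w /(proj2 Zp)[p [? ? ? ? [_ ?]]].
  by exists p; split.
elim: d ds => [|d IH] ds.
  exists [set u], [set u]; split; rewrite ?cards1 ?sub1set //.
  split=> [|w]; rewrite in_set1 // => /eqP->; exists [::]; split=> //.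
  by split=> x; rewrite !inE // => /eqP->; exists v.
have ds' : 2 ^ d <= 2 * s by move: ds; rewrite expnS; lia.
have /IH[A [Z [AC cA cZ [AZ Zp]]]] : 2 ^ d < 4 * s.
  by move: ds; rewrite expnS; lia.
have itD k : iter k nx v \in D by elim: k => //= k; apply: nxD.
have := expC _ (itD d) A AC; rewrite cA => /(_ ds') expA.
(* [Z] contains the tree built so far, fewer than 2^(d+1) vertices; of the 4 * 2^d neighbours at
   least 2^(d+1) are new. *)
have : 2 ^ d.+1 <= #|(C (iter d.+1 nx v) :&: nbh A) :\: Z|.
  rewrite cardsD; have := subset_leq_card (subsetIr (C (iter d.+1 nx v) :&: nbh A) Z).
  by move: cZ expA; rewrite !expnS /=; lia.
case/subset_of_card => A' A'C cA'.
exists A', (A' :|: Z); split=> //.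
- by apply: subset_trans A'C _; apply: subset_trans (subsetDl _ _) (subsetIl _ _).
- apply: leq_ltn_trans (leq_card_setU _ _) _; rewrite cA' [2 ^ d.+2]expnS; lia.
split; first exact: subsetUl.
move=> w wA'; have := subsetP A'C w wA'; rewrite in_setD in_setI => /andP[wZ /andP[wC]].
rewrite inE => /exists_inP[x /Zp[p [pp lp sp up [pZ pC]]] exw].
exists (rcons p w); split.
- by rewrite rcons_path pp lp.
- by rewrite last_rcons.
- by rewrite size_rcons sp.
- by rewrite -rcons_cons rcons_uniq up andbT; apply: contra wZ => /pZ.
split=> y; rewrite -rcons_cons mem_rcons inE => /predU1P[->|].
- by rewrite inE wA'.
- by move/pZ => yZ; rewrite inE yZ orbT.
- by exists (iter d.+1 nx v).
- exact: pC.
Qed.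

End Graphs.

(** The pointer follows shortest walks to [x0] and then alternates between [x0] and [x1]. Hence
    after #|T| steps all walks of the component are on the same edge. *)
Lemma bouncing_pointer (T : finType) (e : rel T) (x0 x1 : T) :
  symmetric e -> e x0 x1 ->
  exists nx : T -> T,
    (forall v, connect e v x0 -> e v (nx v)) /\
    (forall v d, connect e v x0 -> #|T| <= d -> iter d nx v \in [:: x0; x1]).
Proof.
move=> es e01.
pose Q v n := [exists p : n.-tuple T, path e v p && (last v p == x0)].
(* The distance to [x0]; vertices that cannot reach [x0] get #|T| + 1. *)
pose rank v := find (Q v) (iota 0 #|T|.+1).
have rank_le v n : n <= #|T| -> Q v n -> rank v <= n.
  move=> nT Qn; rewrite leqNgt; apply/negP => /(before_find 0).
  by rewrite nth_iota ?ltnS // add0n Qn.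
have rankP v : connect e v x0 -> rank v <= #|T| /\ Q v (rank v).
  case/connectP => p0 ep0 lp0; case/shortenP: ep0 lp0 => p ep up _ lp.
  have pT : size p <= #|T| by apply/ltnW; have := max_card (mem (v :: p)); rewrite (card_uniqP up).
  have Qp : Q v (size p) by apply/existsP; exists (in_tuple p); rewrite ep -lp eqxx.
  have rT := leq_trans (rank_le _ _ pT Qp) pT; split=> //.
  have := @nth_find _ 0 (Q v) (iota 0 #|T|.+1).
  rewrite nth_iota ?ltnS // add0n; apply; apply/hasP; exists (size p) => //.
  by rewrite mem_iota ltnS.
have rank0 v : connect e v x0 -> rank v = 0 -> v = x0.
  case/rankP => _ /[swap] -> /existsP[p]; rewrite (tuple0 p) /=.
  by move/eqP.
have [nx nxP] : exists nx : T -> T, forall v, connect e v x0 ->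
    [/\ e v (nx v), connect e (nx v) x0, v = x0 -> nx v = x1, v = x1 -> nx v = x0 &
      v = x0 \/ rank (nx v) < rank v].
  apply: (@fin_all_exists _ (fun=> T) (fun v y => connect e v x0 ->
    [/\ e v y, connect e y x0, v = x0 -> y = x1, v = x1 -> y = x0 &
      v = x0 \/ rank y < rank v])) => v.
  case: (boolP (connect e v x0)) => [cv|_]; last by exists v.
  have [v0|v0] := eqVneq v x0.
    exists x1 => _; split; rewrite ?v0 //; last by left.
    by apply: connect1; rewrite es.
  have [rT Qr] := rankP _ cv.
  have r0 : 0 < rank v by rewrite lt0n; apply: contra_neq v0; apply: rank0.
  have [v1|v1] := eqVneq v x1.
    exists x0 => _; split; rewrite ?v1 //; first by rewrite es.
    right; rewrite -v1; apply: leq_ltn_trans r0; apply: rank_le => //.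
    by apply/existsP; exists [tuple]; rewrite /= eqxx.
  have /existsP[[p /= /eqP]] := Qr.
  case: p => [|y p] /=; first by move=> r; move: r0; rewrite -r.
  move=> sp /andP[/andP[evy ep] lp].
  exists y => _; split=> //.
  - by apply/connectP; exists p => //; rewrite (eqP lp).
  - by move=> v0'; rewrite v0' eqxx in v0.
  - by move=> v1'; rewrite v1' eqxx in v1.
  - right; rewrite -sp ltnS; apply: rank_le; first by apply: ltnW; rewrite sp.
    by apply/existsP; exists (in_tuple p); rewrite ep.
exists nx; split=> [v /nxP[]//|v d cv Td].
have c0 : connect e x0 x0 by exact: connect0.
have c1 : connect e x1 x0 by apply: connect1; rewrite es.
have stay k w : w \in [:: x0; x1] -> iter k nx w \in [:: x0; x1].
  elim: k => //= k IH /IH; rewrite !inE => /orP[]/eqP->.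
    by have [_ _ ->] := nxP _ c0; rewrite ?eqxx ?orbT.
  by have [_ _ _ ->] := nxP _ c1; rewrite ?eqxx ?orbT.
have : rank v <= d by apply: leq_trans Td; case: (rankP _ cv).
elim: d v cv {Td} => [|d IH] v cv.
  by rewrite leqn0 => /eqP/(rank0 _ cv)->; rewrite inE eqxx.
have [_ cn _ _ [->|rn] rd] := nxP _ cv; first by apply: stay; rewrite inE eqxx.
by rewrite iterSr; apply: IH => //; rewrite -ltnS; apply: leq_trans rn rd.
Qed.

Lemma disjoint_pieces (V : finType) (B : {set V}) (q k : nat) :
  k * q <= #|B| ->
  exists F : nat -> {set V}, forall i, i < k ->
    [/\ F i \subset B, #|F i| = q & forall j, j < k -> i != j -> [disjoint F i & F j]].
Proof.
elim: k B => [|k IH] B kB; first by exists (fun=> set0).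
have [A AB cA] : exists2 A : {set V}, A \subset B & #|A| = q.
  by apply: subset_of_card; apply: leq_trans kB; rewrite mulSn leq_addr.
have /IH[F FP] : k * q <= #|B :\: A|.
  by rewrite cardsD (setIidPr AB) cA; move: kB; rewrite mulSn; lia.
have disjA j : j < k -> [disjoint A & F j].
  move=> /FP[/subsetP FB _ _]; rewrite disjoints_subset; apply/subsetP => x xA.
  by rewrite inE; apply/negP => /FB; rewrite inE xA.
exists (fun i => if i is i'.+1 then F i' else A).
move=> [|i] ik /=; first by split=> // [[|j]] //= jk _; apply: disjA.
have [FB cF Fd] := FP i ik; split=> //.
  by apply: subset_trans FB (subsetDl _ _).
by move=> [|j] jk; rewrite ?eqSS; [rewrite disjoint_sym disjA | apply: Fd].
Qed.

(** [p] is the main path, [p1] and [p2] are branches of the trees at its two ends. The second branch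
    is traversed backwards, from the meeting edge down to its root [u2]. *)
Lemma close_cycle (V : eqType) (e : rel V) (x u1 u2 : V) (p p1 p2 : seq V) :
  symmetric e -> path e x p -> path e u1 p1 -> path e u2 p2 ->
  e (last x p) u1 -> e (last u1 p1) (last u2 p2) -> e x u2 ->
  cycle e ((x :: p) ++ (u1 :: p1) ++ rev (u2 :: p2)).
Proof.
move=> es pp pp1 pp2 e1 e12 e2.
rewrite /= rcons_cat cat_path pp /= e1 rcons_cat cat_path pp1 /=.
rewrite lastI rev_rcons /= e12 rcons_path.
rewrite (eq_path (e' := fun x => e^~ x)) => [|a b]; last exact: es.
rewrite rev_path pp2 /=.
case: p2 {pp2 e12} => [|y p2] /=; first by rewrite es.
by rewrite rev_cons last_rcons es.
Qed.

(** * Sets that fall into small pieces without edges between them *)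

Section Shattering.

Variables (V : finType) (G : rel V) (K : nat).

(** [h] names the piece of each vertex; numbers as names make pieces easy to combine and to
    order. *)
Definition shattered (U : {set V}) :=
  exists h : V -> nat,
    {in U &, forall x y, G x y -> h x = h y} /\
    forall c, #|[set x in U | h x == c]| <= K.

Lemma shattered_small (U : {set V}) : #|U| <= K -> shattered U.
Proof.
move=> UK; exists (fun=> 0); split=> // c.
by apply: leq_trans UK; apply/subset_leq_card/subsetP => x; rewrite inE => /andP[].
Qed.

Lemma shattered_indep (U : {set V}) : 0 < K -> no_edges G U U -> shattered U.
Proof.
move=> K0 indep; exists (fun x => enum_rank x : nat); split=> [x y xU yU|c].
  by rewrite (negPf (indep _ _ xU yU)).
apply: leq_trans K0; apply/card_le1_eqP => x y; rewrite !inE.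
move=> /andP[_ /eqP hx] /andP[_ /eqP hy].
by apply/enum_rank_inj/val_inj; rewrite /= hx hy.
Qed.

Lemma shatteredU (A B : {set V}) :
  symmetric G -> no_edges G A B -> shattered A -> shattered B ->
  shattered (A :|: B).
Proof.
move=> Gs AB [h [hA cA]] [k [kB cB]].
(* Even names for the pieces of [A] and odd ones for those of [B] keep the two families apart. *)
exists (fun x => if x \in A then (h x).*2 else (k x).*2.+1).
have kh x y : x \in A -> y \in A :|: B -> y \notin A -> ~~ G x y.
  by move=> xA /setUP[->//|yB] _; apply: AB.
split=> [x y xU yU Gxy|c].
  have [xA|xA] := boolP (x \in A); have [yA|yA] := boolP (y \in A).
  - by rewrite (hA x y).
  - by have := kh _ _ xA yU yA; rewrite Gxy.
  - by have := kh _ _ yA xU xA; rewrite Gs Gxy.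
  - move: xU yU; rewrite !inE (negPf xA) (negPf yA) => xB yB.
    by rewrite (kB x y).
case: (boolP (odd c)) => oc.
  apply: leq_trans (cB c./2); apply/subset_leq_card/subsetP => x.
  rewrite !inE; case: ifP => [xA|_ /=].
    by case/andP=> _ /eqP hx; move: oc; rewrite -hx odd_double.
  by case/andP=> -> /eqP <-; rewrite /= uphalf_double.
apply: leq_trans (cA c./2); apply/subset_leq_card/subsetP => x.
rewrite !inE; case: ifP => [xA|_ /=].
  by case/andP=> _ /eqP <-; rewrite doubleK eqxx.
by case/andP=> _ /eqP hx; move: oc; rewrite -hx /= odd_double.
Qed.

Lemma shatteredS (A B : {set V}) : A \subset B -> shattered B -> shattered A.
Proof.
move=> /subsetP AB [h [hG hK]]; exists h; split=> [x y /AB xB /AB yB|c].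
  exact: hG.
apply: leq_trans (hK c); apply/subset_leq_card/subsetP => x.
by rewrite !inE => /andP[/AB-> ->].
Qed.

End Shattering.

(** * The edges of one colour *)

Section Cells.

Variables (V I : finType) (e : rel V) (f : V -> I) (s : nat).

Definition cell (a : I) : {set V} := [set x | f x == a].

Definition joined_edge : rel V :=
  fun x y => e x y && joined e s (cell (f x)) (cell (f y)).

Lemma joined_edge_sym : symmetric e -> symmetric joined_edge.
Proof. by move=> es x y; rewrite /joined_edge es joined_sym. Qed.

Variable (U : {set V}).

(** The reduced graph on the cells that meet [U]. Joinedness refers to the full cells and is
    therefore unaffected when [U] shrinks. *)
Definition cell_adj : rel I := fun a b =>
  [&& U :&: cell a != set0, U :&: cell b != set0 & joined e s (cell a) (cell b)].

(* Bipartite double cover of [cell_adj]; a component of [cell_adj] containing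
   [a] is bipartite iff (a, false) and (a, true) are not connected in it. *)
Definition cover_adj : rel (I * bool) := fun v w =>
  cell_adj v.1 w.1 && (w.2 == ~~ v.2).

Lemma cover_adj_sym : symmetric e -> symmetric cover_adj.
Proof.
move=> es [a b] [c d]; rewrite /cover_adj /cell_adj /= (joined_sym _ _ _ es).
by rewrite andbCA; case: b d => [] [].
Qed.

Definition flip (v : I * bool) := (v.1, ~~ v.2).

Lemma connect_flip v w :
  connect cover_adj v w -> connect cover_adj (flip v) (flip w).
Proof.
case/connectP => p pp ->; apply/connectP; exists (map flip p); last by rewrite last_map.
rewrite path_map; apply: sub_path pp => a b; rewrite /cover_adj /=.
by rewrite -(inj_eq negb_inj).
Qed.

(** Flipping a walk from [v] to [w] gives one to the other lift of [w], and the assumption leads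
    from there to [w]. *)
Lemma flip_connected v w : symmetric e ->
  connect cover_adj (w.1, false) (w.1, true) ->
  connect cover_adj v w -> connect cover_adj (flip v) w.
Proof.
move=> es cw /connect_flip/connect_trans; apply.
move: cw; rewrite /flip; case: w => a [] //=.
by rewrite (sym_connect_sym (cover_adj_sym es)).
Qed.

End Cells.

(** * Closing a path to a cycle in a nonbipartite component *)

Section OddComponent.

Variables (V I : finType) (e : rel V) (f : V -> I) (s m d K : nat).
Hypotheses (es : symmetric e) (s0 : 0 < s) (m0 : 0 < m) (d_even : ~~ odd d).
Hypotheses (sd : s <= 2 ^ d) (ds : 2 ^ d < 4 * s) (Id : 2 * #|I| <= d).
Let slack := #|I| * (60 * s).
Hypothesis (mK : m + 2 * slack <= K).
Hypothesis no_cycle :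
  forall p : seq V, uniq p -> size p = m + 2 * d.+1 -> ~~ cycle e p.

Local Notation cell := (cell f).
Local Notation G := (joined_edge e f s).

Variable (U : {set V}).
Hypothesis large : forall a, U :&: cell a != set0 -> 60 * s <= #|U :&: cell a|.
Hypothesis no_peel : forall A : {set V}, A \subset U -> A != set0 -> #|A| <= K ->
  #|A| < #|nbrs G U A|.

Local Notation R2 := (cover_adj e f s U).

(** Otherwise there is a cycle of the excluded length: m vertices on a path found by depth-first
    search and d + 1 on a branch of the tree at each end. *)
Lemma odd_component_absurd (a0 : I) : U :&: cell a0 != set0 ->
  ~~ connect R2 (a0, false) (a0, true).
Proof.
move=> a0U; apply/negP => odd0.
have R2s := cover_adj_sym f s U es.
have R2c := sym_connect_sym R2s.
pose x0 := (a0, false).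
(* The first edge of a walk between the two lifts of [a0] serves as the edge on which both trees
   end. *)
have [b0 Rb0] : exists b0, R2 x0 (b0, true).
  case/connectP: (odd0) => [[|[b []] p]] //= /andP[Rb _] _; first by exists b.
  by move: Rb; rewrite /cover_adj /= andbF.
pose x1 := (b0, true).
have [nx [nxR nx_base]] := bouncing_pointer R2s Rb0.
pose comp v := connect R2 v x0.
have comp_flip a b c : comp (a, b) -> comp (a, c).
  move=> h; have [<-//|bc] := eqVneq b c.
  have -> : (a, c) = flip (a, b) by rewrite /flip /=; case: b c bc {h} => [] [].
  by apply: flip_connected h.
have comp_step v w : comp v -> R2 v w -> comp w.
  by move=> cv vw; apply: connect_trans cv; rewrite R2c; apply: connect1.
have present v : comp v -> U :&: cell v.1 != set0.
  move=> cv; have := nxR _ cv; rewrite /cover_adj /cell_adj.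
  by case/andP=> /and3P[].
(* Every cell supplies four disjoint sets, one for each sheet of the cover and
   each of the two trees. *)
have [F FP] : exists F : I -> nat -> {set V}, forall a, U :&: cell a != set0 ->
    forall i, i < 4 -> [/\ F a i \subset U :&: cell a, #|F a i| = 14 * s &
      forall j, j < 4 -> i != j -> [disjoint F a i & F a j]].
  apply: (@fin_all_exists _ (fun=> nat -> {set V}) (fun a Fa =>
    U :&: cell a != set0 ->
    forall i, i < 4 -> [/\ Fa i \subset U :&: cell a, #|Fa i| = 14 * s &
      forall j, j < 4 -> i != j -> [disjoint Fa i & Fa j]])) => a.
  have [_|/large big] := eqVneq (U :&: cell a) set0; first by exists (fun=> set0).
  have [F FP] : exists F : nat -> {set V}, forall i, i < 4 ->
      [/\ F i \subset U :&: cell a, #|F i| = 14 * s &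
        forall j, j < 4 -> i != j -> [disjoint F i & F j]].
    by apply: disjoint_pieces; apply: leq_trans big; lia.
  by exists F.
(* [b] is the sheet of the double cover and [tag] tells the two trees apart. *)
pose idx (b tag : bool) := b + tag.*2.
have idx4 b tag : idx b tag < 4 by case: b tag => [] [].
have idx_inj b tag b' tag' : idx b tag = idx b' tag' -> (b, tag) = (b', tag').
  by case: b tag b' tag' => [] [] [] [].
pose S (v : I * bool * bool) := F v.1.1 (idx v.1.2 v.2).
pose nxt (v : I * bool * bool) := (nx v.1, v.2).
pose D := [set v : I * bool * bool | comp v.1].
have nxD : {in D, forall v, nxt v \in D}.
  by move=> v; rewrite !inE /= => cv; apply: comp_step (nxR _ cv).
have SP v : v \in D -> S v \subset U :&: cell v.1.1 /\ #|S v| = 14 * s.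
  by rewrite inE => /present/FP/(_ _ (idx4 v.1.2 v.2))[].
have joinS v w (X Y : {set V}) : v \in D -> w \in D -> R2 v.1 w.1 ->
    X \subset U :&: cell v.1.1 -> Y \subset U :&: cell w.1.1 ->
    s <= #|X| -> s <= #|Y| -> exists x y, [/\ x \in X, y \in Y & e x y].
  move=> vD wD /andP[/and3P[_ _ /joinedP jvw] _] XU YU.
  apply: jvw; first by apply: subset_trans XU (subsetIr _ _).
  by apply: subset_trans YU (subsetIr _ _).
have disjS v w : v \in D -> w \in D -> v != w -> forall x, x \in S v -> x \notin S w.
  move=> vD wD vw x xv; apply/negP => xw.
  have xc y : y \in D -> x \in S y -> f x = y.1.1.
    by case/SP => /subsetP/(_ x) h _ /h; rewrite !inE => /andP[_ /eqP].
  have fvw : v.1.1 = w.1.1 by rewrite -(xc v) // (xc w).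
  have ivw : idx v.1.2 v.2 != idx w.1.2 w.2.
    apply: contra_neq vw => /idx_inj[]; move: fvw.
    by case: v w {vD wD xv xw} => [[a b] c] [[a' b'] c'] /= -> -> ->.
  move: (vD); rewrite inE => /present/FP/(_ _ (idx4 v.1.2 v.2))[_ _].
  move=> /(_ _ (idx4 w.1.2 w.2) ivw)/pred0P/(_ x) /=.
  by rewrite /S in xv xw; rewrite xv fvw xw.
have [C [CS cC expC]] : exists C : I * bool * bool -> {set V},
    [/\ forall v, C v \subset S v, forall v, #|S v| <= #|C v| + s &
        {in D, forall v (A : {set V}), A \subset C v -> #|A| <= 2 * s ->
           4 * #|A| <= #|C (nxt v) :&: nbh e A|}].
  apply: expanding_core => // [v vD|v vD]; first by have [_ ->] := SP v vD.
  have [Sv _] := SP v vD; have [Sn _] := SP _ (nxD v vD).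
  apply/joinedP => X Y XS YS; apply: (@joinS v (nxt v)) => //.
  - exact: nxD.
  - by apply: nxR; rewrite inE in vD.
  - exact: subset_trans XS Sv.
  - exact: subset_trans YS Sn.
(* The node where a tree is rooted when the path ends in cell [a]: [att true] for the last vertex of
   the path, with tag false, and [att false] for the first, with tag true. *)
pose att (b : bool) a : I * bool * bool := (nx (a, b), ~~ b).
have attD b a : comp (a, false) -> att b a \in D.
  by move=> /(comp_flip a _ b) ca; rewrite inE; apply: comp_step (nxR _ ca).
(* Vertices that cannot be attached to the tree; by joinedness there are at most s of them. *)
pose atyp b a := [set x in U :&: cell a | [forall u in C (att b a), ~~ e x u]].
have atyp_small b a : comp (a, false) -> #|atyp b a| <= s.
  move=> ca; rewrite leqNgt; apply/negP => big.
  have caD : ((a, b), b) \in D by rewrite inE /=; apply: comp_flip ca.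
  have [Satt cS] := SP _ (attD b a ca).
  have [|||||x [y [xX yY exy]]] := @joinS _ _ (atyp b a) (C (att b a)) caD (attD b a ca).
  - by rewrite /=; apply/nxR/(comp_flip _ _ _ ca).
  - by apply/subsetP => x; rewrite inE => /andP[].
  - exact: subset_trans (CS _) Satt.
  - exact: ltnW.
  - by have := cC (att b a); rewrite cS; lia.
  - by move: xX; rewrite inE => /andP[_ /forall_inP/(_ y yY)]; rewrite exy.
(* Withheld from the path: four reserved sets of 14s vertices and two atypical sets of at most s, in
   all at most 58s per cell. *)
pose junk a := (\bigcup_(i < 4) F a i) :|: (\bigcup_b atyp b a).
have junk_small a : comp (a, false) -> #|junk a| <= 60 * s.
  move=> ca; apply: leq_trans (leq_card_setU _ _) _.
  have c1 : #|\bigcup_(i < 4) F a i| <= #|'I_4| * (14 * s).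
    by apply: leq_card_bigcup => i; have [_ -> _] := FP a (present _ ca) i (ltn_ord i).
  have c2 : #|\bigcup_b atyp b a| <= #|{: bool}| * s.
    by apply: leq_card_bigcup => b; apply: atyp_small.
  by move: c1 c2; rewrite card_ord card_bool; lia.
pose WK := [set x in U | comp (f x, false)].
pose W := [set x in WK | x \notin junk (f x)].
have cWK : #|WK| <= #|W| + slack.
  have : #|WK :\: W| <= slack.
    have : WK :\: W \subset \bigcup_(a | comp (a, false)) junk a.
      apply/subsetP => x; rewrite inE => /andP[xW xK].
      move: xW; rewrite inE xK negbK => xj.
      by apply/bigcupP; exists (f x) => //; move: xK; rewrite inE => /andP[].
    move/subset_leq_card/leq_trans; apply.
    rewrite /slack -sum_nat_const big_mkcond /=.
    elim/big_ind2: _ => [|A x B y Ax By|a _]; first by rewrite cards0.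
      by apply: leq_trans (leq_card_setU _ _) (leq_add Ax By).
    by case: ifP => [/junk_small//|_]; rewrite cards0.
  by have := cardsID W WK; have := subset_leq_card (subsetIr WK W); lia.
have nbrWK x y : x \in WK -> y \in U -> G x y -> y \in WK.
  rewrite !inE => /andP[xU cx] yU /andP[_ jxy]; rewrite yU /=.
  apply: (comp_flip _ true); apply: comp_step cx _.
  rewrite /cover_adj /cell_adj /= jxy !andbT.
  by apply/andP; split; apply/set0Pn; [exists x|exists y]; rewrite !inE eqxx ?xU ?yU.
(* Inside [U] no edge of [G] leaves [WK], so a small [WK] could be peeled off. *)
have WKbig : K < #|WK|.
  rewrite ltnNge; apply/negP => WKs.
  have : #|WK| < #|nbrs G U WK|.
    apply: no_peel => //; first by apply/subsetP => x; rewrite inE => /andP[].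
    case/set0Pn: a0U => x; rewrite !inE => /andP[xU /eqP fx].
    by apply/set0Pn; exists x; rewrite inE xU fx; apply: connect0.
  suff -> : nbrs G U WK = set0 by rewrite cards0.
  apply/setP => y; rewrite in_set0; apply/negP => /setIP[/setDP[yU yW]].
  by rewrite inE => /exists_inP[x xW /(nbrWK _ _ xW yU)]; apply/negP.
have slack0 : 0 < slack.
  by rewrite /slack muln_gt0 (_ : 0 < 60 * s) ?andbT; [apply/card_gt0P; exists a0|lia].
have WU : W \subset U.
  by apply/subsetP => x; rewrite inE => /andP[]; rewrite inE => /andP[].
(* Without a path on m vertices in [W] there is a set of m + slack vertices with at most m - 1
   neighbours in [W], hence fewer than m + slack in [U]; this set could be peeled off. *)
have [||T [TW cT nT]] := @dfs_separation V e W m.-1 (m + slack) _ es; last first.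
- have : #|T| < #|nbrs G U T|.
    apply: no_peel; first exact: subset_trans TW WU.
      by rewrite -card_gt0 cT; lia.
    by rewrite cT; lia.
  have : nbrs G U T \subset nbrs e W T :|: (WK :\: W).
    apply/subsetP => y /setIP[/setDP[yU yT]].
    rewrite inE => /exists_inP[x xT Gxy].
    have xWK : x \in WK by move/subsetP: TW => /(_ x xT); rewrite inE => /andP[].
    have yWK := nbrWK _ _ xWK yU Gxy.
    rewrite in_setU in_setD yWK andbT; case: (boolP (y \in W)) => yW /=; last by rewrite orbT.
    rewrite orbF in_setI in_setD yT yW inE; apply/exists_inP; exists x => //.
    by case/andP: Gxy.
  move/subset_leq_card; have := (leq_card_setU (nbrs e W T) (WK :\: W)).1.
  have : #|WK :\: W| <= slack.
    by rewrite cardsD (setIidPr _); [lia|apply/subsetP => x; rewrite inE => /andP[]].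
  by lia.
- by lia.
move=> x q pq uq qW; rewrite ltnNge; apply/negP => mq.
pose p := take m.-1 q.
have pp : path e x p by rewrite take_path.
have up : uniq (x :: p).
  by move: uq; rewrite -[q](cat_take_drop m.-1) -cat_cons cat_uniq => /andP[].
have pW : {subset x :: p <= W}.
  move=> y yp; apply: qW; move: yp; rewrite !inE => /orP[->//|/mem_take->].
  by rewrite orbT.
have sp : size p = m.-1 by rewrite size_takel.
have attach b y : y \in W -> exists2 u, u \in C (att b (f y)) & e y u.
  rewrite !inE negb_or => /andP[/andP[yU _] /andP[_ yj]].
  have : y \notin atyp b (f y) by apply: contra yj => yb; apply/bigcupP; exists b.
  rewrite !inE yU eqxx /= => /forall_inPn[u uC]; rewrite negbK => eyu.
  by exists u.
have compW y : y \in W -> comp (f y, false).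
  by rewrite !inE => /andP[/andP[]].
have xW : x \in W by apply: pW; rewrite mem_head.
have zW : last x p \in W by apply: pW; apply: mem_last.
have [u1 u1C e1] := attach true _ zW.
have [u2 u2C e2] := attach false _ xW.
(* As d is even, a walk ends on the sheet where it starts, and [x0] and [x1] lie on different
   sheets. The choice of sheets in [att] thus sends the two trees to opposite ends of the base
   edge. *)
have ends b a : comp (a, false) ->
    iter d nxt (att b a) = (if b then x0 else x1, ~~ b).
  move=> ca.
  have it v : iter d nxt v = (iter d nx v.1, v.2).
    by elim: (d) v => [|k IH] [v c] //=; rewrite IH.
  have par k v : comp v -> (iter k nx v).2 = odd k (+) v.2 /\ comp (iter k nx v).
    move=> cv; elim: k => [|k [IH ck]] //=.
    have Rk := nxR _ ck; split; last exact: comp_step Rk.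
    by case/andP: Rk => _ /eqP->; rewrite IH addNb.
  have cn : comp (nx (a, b)) by have := attD b a ca; rewrite inE.
  rewrite it /=; congr pair.
  have : iter d nx (nx (a, b)) \in [:: x0; x1].
    by apply: nx_base => //; rewrite card_prod card_bool mulnC.
  have := (par d _ cn).1; rewrite (negPf d_even) addFb.
  have -> : (nx (a, b)).2 = ~~ b.
    by have /andP[_ /eqP->] := nxR _ (comp_flip _ _ b ca).
  by rewrite !inE => h /orP[]/eqP E; move: h; rewrite E /=; case: b {cn E}.
(* Each tree stays within one tag, which keeps the two trees disjoint. *)
pose Dt (t : bool) := [set v in D | v.2 == t].
have nxDt t : {in Dt t, forall v, nxt v \in Dt t}.
  by move=> v /setIdP[/nxD vD vt]; apply/setIdP.
have expDt t : {in Dt t, forall v (A : {set V}), A \subset C v -> #|A| <= 2 * s ->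
    4 * #|A| <= #|C (nxt v) :&: nbh e A|} by move=> v /setIdP[/expC].
have attDt b a : comp (a, false) -> att b a \in Dt (~~ b).
  by move=> ca; apply/setIdP; split; [exact: attD|].
have [A1 [A1C cA1 tree1]] := exact_depth_tree (nxDt _) (@expDt _) ds (attDt true _ (compW _ zW)) u1C.
have [A2 [A2C cA2 tree2]] := exact_depth_tree (nxDt _) (@expDt _) ds (attDt false _ (compW _ xW)) u2C.
rewrite ends ?compW // in A1C; rewrite ends ?compW // in A2C.
have D1 : (x0, false) \in D by rewrite inE; apply: connect0.
have D2 : (x1, true) \in D by rewrite inE; apply: comp_step (connect0 _ _) Rb0.
have [S1 _] := SP _ D1; have [S2 _] := SP _ D2.
(* Both last layers have 2^d >= s vertices, and their cells are joined. *)
have [|||||w1 [w2 [w1A w2A e12]]] := @joinS _ _ A1 A2 D1 D2.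
- exact: Rb0.
- by apply: subset_trans A1C (subset_trans (CS _) S1).
- by apply: subset_trans A2C (subset_trans (CS _) S2).
- by rewrite cA1.
- by rewrite cA2.
have [p1 [pp1 lp1 sp1 up1 p1C]] := tree1 _ w1A.
have [p2 [pp2 lp2 sp2 up2 p2C]] := tree2 _ w2A.
rewrite -lp1 -lp2 in e12.
apply/negP: (close_cycle es pp pp1 pp2 e1 e12 e2); apply: no_cycle; last first.
  by rewrite !size_cat size_rev /= sp sp1 sp2 prednK // mul2n -addnn.
have inC t y : (exists2 v, v \in Dt t & y \in C v) ->
    exists v, [/\ v \in D, v.2 = t & y \in S v].
  by case=> v /setIdP[vD /eqP vt] yC; exists v; split=> //; apply: subsetP (CS v) _ yC.
have notW t y : (exists2 v, v \in Dt t & y \in C v) -> y \notin W.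
  case/inC => v [vD _ yS]; have [Sv _] := SP v vD.
  have := subsetP Sv _ yS; rewrite !inE negb_and => /andP[_ /eqP fy].
  apply/orP; right; rewrite negbK fy; apply/orP; left; apply/bigcupP.
  by exists (Ordinal (idx4 v.1.2 v.2)).
have tag_disj y : (exists2 v, v \in Dt false & y \in C v) ->
    ~ (exists2 v, v \in Dt true & y \in C v).
  move=> /inC[v [vD vt yv]] /inC[w [wD wt yw]].
  have vw : v != w by apply: contra_eq_neq vt => ->; rewrite wt.
  by have := disjS v w vD wD vw y yv; rewrite yw.
rewrite cat_uniq up cat_uniq up1 rev_uniq up2 !andbT !andTb.
apply/andP; split; apply/hasPn => y.
  rewrite mem_cat mem_rev => /orP[/p1C|/p2C] /notW; apply: contra; exact: pW.
rewrite mem_rev => /p2C y2; apply/negP => /p1C y1; exact: tag_disj y1 y2.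
Qed.
End OddComponent.

(** Strong induction on |U|. A small trace of a cell is discarded; a set that does not expand is
    kept as one piece while its neighbours are dropped; if neither occurs, the components of the
    reduced graph are bipartite, and the larger class of one of them is kept. *)
Lemma large_shattered_subset (V I : finType) (e : rel V) (f : V -> I)
    (s m d K : nat) (U : {set V}) :
  symmetric e -> 0 < s -> 0 < m -> ~~ odd d ->
  s <= 2 ^ d -> 2 ^ d < 4 * s -> 2 * #|I| <= d ->
  m + 2 * (#|I| * (60 * s)) <= K ->
  (forall p : seq V, uniq p -> size p = m + 2 * d.+1 -> ~~ cycle e p) ->
  exists U' : {set V}, [/\ U' \subset U, #|U| <= 2 * #|U'| + #|I| * (60 * s) &
    shattered (joined_edge e f s) K U'].
Proof.
move=> es s0 m0 d_even sd ds Id mK no_cycle.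
set G := joined_edge e f s; have Gs : symmetric G by apply: joined_edge_sym.
(* Discarding a trace costs fewer than 60s vertices and removes its cell from this set, so the total
   loss is bounded by its size. *)
pose touched (X : {set V}) := [set a | X :&: cell f a != set0].
have touchedS (X Y : {set V}) : X \subset Y -> touched X \subset touched Y.
  move=> XY; apply/subsetP => a; rewrite !inE -!card_gt0 => /leq_trans; apply.
  by apply/subset_leq_card/setSI.
suff [U' [? cU' ?]] : exists U' : {set V}, [/\ U' \subset U,
    #|U| <= 2 * #|U'| + #|touched U| * (60 * s) & shattered G K U'].
  exists U'; split=> //; apply: leq_trans cU' _.
  by rewrite leq_add2l leq_mul2r max_card orbT.
have [c] := ubnP #|U|; elim: c U => // c IH U Uc.
(* [B] is kept and the induction continues in [U1]; at least half of the vertices removed from [U]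
   belong to [B]. *)
have rec (B U1 : {set V}) : B \subset U -> U1 \subset U :\: B -> #|U1| < #|U| ->
    #|U| <= 2 * #|B| + #|U1| -> no_edges G B U1 -> shattered G K B ->
    exists U' : {set V}, [/\ U' \subset U,
      #|U| <= 2 * #|U'| + #|touched U| * (60 * s) & shattered G K U'].
  move=> BU; rewrite subsetD => /andP[U1U U1B] cU1 cU nB sB.
  have [|U' [U'1 cU' sU']] := IH U1; first by lia.
  exists (B :|: U'); split.
  - by rewrite subUset BU (subset_trans U'1).
  - rewrite cardsU disjoint_setI0 ?cards0 ?subn0.
      have := leq_mul (subset_leq_card (touchedS _ _ U1U)) (leqnn (60 * s)).
      by move: cU cU'; lia.
    by rewrite disjoint_sym; apply: disjointWl U1B.
  - by apply: shatteredU => // x y xB /(subsetP U'1); apply: nB.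
have [->|U0] := eqVneq U set0.
  exists set0; split; rewrite ?cards0 ?sub0set //.
  by apply: shattered_small; rewrite cards0.
case: (boolP [exists a in touched U, #|U :&: cell f a| < 60 * s]).
  case/exists_inP => a; rewrite inE => aU small.
  have cU := cardsID (cell f a) U; rewrite -card_gt0 in aU.
  have [|U' [U'1 cU' sU']] := IH (U :\: cell f a); first by lia.
  exists U'; split=> //; first exact: subset_trans U'1 (subsetDl _ _).
  have : touched (U :\: cell f a) \subset touched U :\ a.
    apply/subsetP => b bU; rewrite in_setD1 (subsetP (touchedS _ _ _) b bU) ?subsetDl //.
    rewrite andbT; apply: contraTneq bU => ->; rewrite inE negbK.
    by apply/eqP/setP => x; rewrite !inE; case: (f x == a); rewrite ?andbF.
  move/subset_leq_card => cT; rewrite (cardsD1 a (touched U)).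
  have -> : a \in touched U by rewrite inE -card_gt0.
  have := leq_mul cT (leqnn (60 * s)).
  by move: cU cU' small; rewrite mulnDl mul1n; lia.
move/exists_inPn => large.
case: (boolP [exists A : {set V}, [&& A \subset U, A != set0, #|A| <= K &
    #|nbrs G U A| <= #|A|]]).
  case/existsP => A /and4P[AU A0 AK nA].
  apply: (rec A (U :\: (A :|: nbrs G U A))) => //.
  - by apply/setDS/subsetUl.
  - rewrite -[X in _ < X](cardsID (A :|: nbrs G U A) U) -addn1 addnC leq_add2r.
    rewrite card_gt0; apply: contraNneq A0 => E; rewrite -subset0 -E.
    by rewrite subsetI AU subsetUl.
  - have -> : U :\: (A :|: nbrs G U A) = (U :\: A) :\: nbrs G U A by rewrite setDDl.
    have := cardsID A U; have := cardsID (nbrs G U A) (U :\: A).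
    rewrite (setIidPr AU); have := subset_leq_card (subsetIr (U :\: A) (nbrs G U A)).
    by lia.
  - move=> x y xA; rewrite !in_setD in_setU negb_or => /andP[/andP[yA yn] yU].
    apply: contra yn => Gxy; rewrite in_setI in_setD yA yU inE.
    by apply/exists_inP; exists x.
  - exact: shattered_small.
move/existsPn => no_peel.
have [a0 a0U] : exists a, a \in touched U.
  case/set0Pn: U0 => x xU; exists (f x); rewrite inE; apply/set0Pn; exists x.
  by rewrite !inE xU eqxx.
pose R2 := cover_adj e f s U.
have nconn : ~~ connect R2 (a0, false) (a0, true).
  apply: (@odd_component_absurd _ _ _ _ _ m d K) => //.
  - by move=> a aU; rewrite leqNgt; apply: large; rewrite inE.
  - move=> A AU A0 AK; have := no_peel A.
    by rewrite AU A0 AK /= -ltnNge.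
  - by rewrite inE in a0U.
have R2s := cover_adj_sym f s U es.
have R2c := sym_connect_sym R2s.
pose comp b a := connect R2 (a, b) (a0, false).
have step b x y : x \in U -> y \in U -> G x y -> comp b (f x) -> comp (~~ b) (f y).
  move=> xU yU /andP[_ jxy]; apply: connect_trans; apply: connect1.
  rewrite /R2 R2s /cover_adj /cell_adj /= jxy eqxx !andbT.
  by apply/andP; split; apply/set0Pn; [exists x|exists y]; rewrite !inE eqxx ?xU ?yU.
have excl b a : comp b a -> ~~ comp (~~ b) a.
  move=> c1; apply: contra nconn => /connect_flip; rewrite /flip /= negbK => c2.
  by apply: connect_trans c2; rewrite R2c.
(* The two classes of the bipartite component of [a0]; by [step] and [excl] each of them is
   independent. *)
pose Bc b := [set x in U | comp b (f x)].
have cB : #|Bc false :|: Bc true| <= #|Bc false| + #|Bc true| by apply: leq_card_setU.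
have [b cb] : exists b, #|Bc false :|: Bc true| <= 2 * #|Bc b|.
  by case: (leqP #|Bc false| #|Bc true|) => ?; [exists true|exists false]; lia.
have BU : Bc false :|: Bc true \subset U.
  by apply/subsetP => x; rewrite !inE => /orP[]/andP[].
apply: (rec (Bc b) (U :\: (Bc false :|: Bc true))).
- by apply/subsetP => x; rewrite inE => /andP[].
- by apply: setDS; case: (b); [exact: subsetUr|exact: subsetUl].
- rewrite cardsD (setIidPr BU); have := subset_leq_card BU.
  suff : 0 < #|Bc false :|: Bc true| by lia.
  rewrite inE in a0U; case/set0Pn: a0U => x; rewrite !inE => /andP[xU /eqP fx].
  by apply/card_gt0P; exists x; rewrite !inE xU fx /= /comp connect0.
- by rewrite cardsD (setIidPr BU); lia.
- move=> x y; rewrite !inE => /andP[xU cx] /andP[yB yU]; apply: contra yB => Gxy.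
  by rewrite yU /=; have := step b x y xU yU Gxy cx; case: (b) => /= ->; rewrite ?orbT.
- apply: shattered_indep; first by apply: leq_trans mK; lia.
  move=> x y; rewrite !inE => /andP[xU cx] /andP[yU cy]; apply: contraL cy => Gxy.
  by have /excl := step b x y xU yU Gxy cx; rewrite negbK.
Qed.

(** * A partition into cells *)

(* Cut the list of vertices, sorted by class, into consecutive blocks of length
   L.  Along this list both the block number and the class number are monotone,
   so their sum determines both. *)
Lemma chop_classes (V T : finType) (f : V -> T) (L : nat) : 0 < L ->
  exists g : V -> 'I_(#|V| %/ L + #|T|),
    (forall x y, g x = g y -> f x = f y) /\ forall c, #|cell g c| <= L.
Proof.
move=> L0.
pose key x := enum_rank (f x) * #|V| + enum_rank x.
have keyK x : key x %/ #|V| = enum_rank (f x) /\ key x %% #|V| = enum_rank x.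
  have V0 : 0 < #|V| by apply/card_gt0P; exists x.
  by rewrite /key divnMDl // modnMDl divn_small ?modn_small ?addn0.
have key_inj : injective key.
  move=> x y kxy; apply/enum_rank_inj/val_inj.
  by have [_ /= <-] := keyK x; have [_ /= <-] := keyK y; rewrite kxy.
pose pos x := #|[set y | key y < key x]|.
have pos_lt x y : key x < key y -> pos x < pos y.
  move=> kxy; apply/proper_card/properP; split.
    by apply/subsetP => z; rewrite !inE => /ltn_trans; apply.
  by exists x; rewrite !inE ?ltnn.
have pos_le x y : key x <= key y -> pos x <= pos y.
  by rewrite leq_eqVlt => /predU1P[/key_inj->//|/pos_lt/ltnW].
have pos_inj : injective pos.
  move=> x y pxy; apply: key_inj; have [/pos_lt|/pos_lt|//] := ltngtP (key x) (key y).
    by rewrite pxy ltnn.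
  by rewrite pxy ltnn.
have posV x : pos x <= #|V| by apply: max_card.
pose g0 x := pos x %/ L + enum_rank (f x).
have g0_lt x : g0 x < #|V| %/ L + #|T|.
  by rewrite -addnS leq_add ?leq_div2r.
have g0P x y : g0 x = g0 y -> pos x %/ L = pos y %/ L /\ f x = f y.
  wlog kxy : x y / key x <= key y.
    by move=> H; case: (leqP (key x) (key y)) => [/H//|/ltnW/H{}H /esym/H[-> ->]].
  have p1 := leq_div2r L (pos_le _ _ kxy).
  have p2 : enum_rank (f x) <= enum_rank (f y).
    by have [<- _] := keyK x; have [<- _] := keyK y; apply: leq_div2r.
  rewrite /g0 => E.
  have [E1 E2] : pos x %/ L = pos y %/ L /\ enum_rank (f x) = enum_rank (f y) :> nat.
    by lia.
  by split=> //; apply/enum_rank_inj/val_inj.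
exists (fun x => Ordinal (g0_lt x)); split=> [x y [/g0P[]]//|c].
have [->|[x0]] := set_0Vmem (cell (fun x => Ordinal (g0_lt x)) c); first by rewrite cards0.
set A := cell _ c; move=> x0A.
have divA x : x \in A -> pos x %/ L = pos x0 %/ L.
  move: x0A; rewrite !inE => /eqP <- /eqP E.
  by have [] := g0P x x0 (congr1 val E).
rewrite cardE -(size_map pos) -[leqRHS](size_iota (pos x0 %/ L * L)).
apply: uniq_leq_size; first by rewrite map_inj_uniq ?enum_uniq.
move=> _ /mapP[x + ->]; rewrite mem_enum => /divA <-.
by rewrite mem_iota leq_divM -mulSnr ltn_ceil.
Qed.

Section Partition.

Variables (Q V : finType) (e : Q -> rel V).

Definition silent (I : finType) (f : V -> I) (i : Q) (a b : I) :=
  [forall x in cell f a, forall y in cell f b, ~~ e i x y].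

Definition bad_pair (I : finType) (f : V -> I) (s : nat) (a b : I) :=
  [exists i, ~~ joined (e i) s (cell f a) (cell f b) && ~~ silent f i a b].

(** Pairs of vertices rather than of cells, so that small cells weigh little. *)
Definition bad_vertices (I : finType) (f : V -> I) (s : nat) :=
  [set p : V * V | bad_pair f s (f p.1) (f p.2)].

(** The potential of the refinement: bounded by |Q| |V|^2, and monotone because silent pairs of
    cells stay silent on subcells. *)
Definition silent_triples (I : finType) (f : V -> I) :=
  [set t : Q * (V * V) | silent f t.1 (f t.2.1) (f t.2.2)].

Lemma card_fibers (T J : finType) (h : T -> J) (A : {set T}) :
  #|A| = \sum_j #|[set x in A | h x == j]|.
Proof.
rewrite -sum1_card (partition_big h xpredT) //=; apply: eq_bigr => j _.
by rewrite -sum1_card; apply: eq_bigl => x; rewrite inE.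
Qed.

(** The number of labels a vertex can get in one refinement: one of 2k cells and, for each side of a
    pair, membership in the witness sets for the 2k partner cells. *)
Definition next_size (k : nat) := 2 * k * 2 ^ (2 * k) * 2 ^ (2 * k).

(* Witnesses of failing joinedness, for all bad pairs at once, become silent pairs
   of cells of the refinement. *)
Lemma refine_partition (k M : nat) (f : V -> 'I_(2 * k)) :
  0 < k -> k * M <= #|V| -> 0 < M ->
  (forall a, #|cell f a| <= (#|V| %/ k).+1) ->
  exists f' : V -> 'I_(2 * next_size k),
    (forall a, #|cell f' a| <= (#|V| %/ next_size k).+1) /\
    4 * M ^ 2 * #|silent_triples f| + #|bad_vertices f ((#|V| %/ k).+1 %/ M)|
      <= 4 * M ^ 2 * #|silent_triples f'|.
Proof.
move=> k0 kM M0 fL; set L := (#|V| %/ k).+1 in fL *; set s := L %/ M.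
have LMs : L <= 2 * M * s.
  have ML : M <= L by apply: leqW; rewrite leq_divRL // mulnC.
  have s0 : 0 < s by rewrite divn_gt0.
  by have := divn_eq L M; rewrite -/s; have := ltn_pmod L M0; nia.
pose I : finType := 'I_(2 * k).
have [w wP] : exists w : I * I -> {set V} * {set V}, forall ab, bad_pair f s ab.1 ab.2 ->
    [/\ (w ab).1 \subset cell f ab.1, (w ab).2 \subset cell f ab.2,
      s <= #|(w ab).1|, s <= #|(w ab).2| &
      exists i, ~~ silent f i ab.1 ab.2 /\ no_edges (e i) (w ab).1 (w ab).2].
  apply: (@fin_all_exists _ (fun=> {set V} * {set V})%type (fun ab w =>
    bad_pair f s ab.1 ab.2 ->
    [/\ w.1 \subset cell f ab.1, w.2 \subset cell f ab.2,
      s <= #|w.1|, s <= #|w.2| &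
      exists i, ~~ silent f i ab.1 ab.2 /\ no_edges (e i) w.1 w.2])) => ab.
  case: (boolP (bad_pair _ _ _ _)) => [|_]; last by exists (set0, set0).
  case/existsP => i /andP[/forallPn[X /forallPn[Y]]].
  rewrite negb_imply => /andP[/and4P[Xa Yb sX sY] /exists_inPn XY] nsil.
  exists (X, Y) => _; split=> //; exists i; split=> // x y xX yY.
  by have /exists_inPn := XY _ xX; apply.
pose h x : I * {ffun I -> bool} * {ffun I -> bool} :=
  (f x, [ffun b => x \in (w (f x, b)).1], [ffun a => x \in (w (a, f x)).2]).
have cT : #|{: I * {ffun I -> bool} * {ffun I -> bool}}| = next_size k.
  by rewrite !card_prod card_ffun card_bool card_ord.
have next0 : 0 < next_size k by rewrite !muln_gt0 k0 !expn_gt0.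
have [g [gh gL]] := chop_classes h (ltn0Sn (#|V| %/ next_size k)).
(* There are at most [next_size k] full blocks and as many classes, whence the factor 2 in the
   number of cells. *)
have lew : #|V| %/ (#|V| %/ next_size k).+1 + #|{: I * {ffun I -> bool} * {ffun I -> bool}}| <= 2 * next_size k.
  rewrite cT mul2n -addnn leq_add2r; apply: ltnW; rewrite ltn_divLR // mulnC.
  by rewrite -ltn_divLR // ltnS.
pose f' x := widen_ord lew (g x).
have f'h x y : f' x = f' y -> h x = h y.
  by move=> E; apply: gh; apply/val_inj; exact: (congr1 val E).
have f'f x y : f' x = f' y -> f x = f y by move/f'h; case.
exists f'; split.
  move=> a; have [->|[x0]] := set_0Vmem (cell f' a); first by rewrite cards0.
  rewrite inE => /eqP <-; apply: leq_trans (gL (g x0)).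
  apply/subset_leq_card/subsetP => y; rewrite !inE => /eqP E.
  by apply/eqP/val_inj; exact: (congr1 val E).
have mono : silent_triples f \subset silent_triples f'.
  apply/subsetP => [[i [x y]]]; rewrite !inE /= => /forall_inP sil.
  apply/forall_inP => u; rewrite inE => /eqP/f'f fu.
  apply/forall_inP => v; rewrite inE => /eqP/f'f fv.
  have uc : u \in cell f (f x) by rewrite inE fu.
  by have /forall_inP/(_ v) := sil u uc; apply; rewrite inE fv.
(* The pairs of vertices inside witness rectangles; on each of them some colour becomes silent that
   was not so before. *)
pose new := [set p : V * V | [&& bad_pair f s (f p.1) (f p.2),
   p.1 \in (w (f p.1, f p.2)).1 & p.2 \in (w (f p.1, f p.2)).2]].
have new_le : #|new| <= #|silent_triples f' :\: silent_triples f|.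
  apply: leq_trans (leq_imset_card snd _); apply/subset_leq_card/subsetP => [[x y]].
  rewrite inE /= => /and3P[bxy xw yw].
  have [_ _ _ _ [i [nsil noe]]] := wP (f x, f y) bxy.
  apply/imsetP; exists (i, (x, y)) => //; rewrite !inE /= nsil.
  apply/forall_inP => u; rewrite inE => /eqP/f'h[fu /ffunP/(_ (f y)) hu _].
  apply/forall_inP => v; rewrite inE => /eqP/f'h[fv _ /ffunP/(_ (f x)) hv].
  by apply: noe; [move: hu; rewrite !ffunE fu xw | move: hv; rewrite !ffunE fv yw].
(* As L <= 2Ms, a witness rectangle fills at least the fraction 1 / (4 M^2) of its pair of cells. *)
have bad_le : #|bad_vertices f s| <= 4 * M ^ 2 * #|new|.
  pose ff (p : V * V) := (f p.1, f p.2).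
  rewrite (card_fibers ff) (card_fibers ff new) big_distrr /=.
  apply: leq_sum => [[a b]] _.
  have [bab|nb] := boolP (bad_pair f s a b); last first.
    rewrite [X in X <= _](_ : _ = 0) //; apply/eqP; rewrite cards_eq0; apply/eqP/setP => p.
    rewrite !inE; apply/negP => /andP[bp /eqP[fa fb]].
    by move: nb; rewrite -fa -fb bp.
  have [wa wb sa sb _] := wP (a, b) bab.
  apply: (@leq_trans (#|cell f a| * #|cell f b|)).
    rewrite -cardsX; apply/subset_leq_card/subsetP => p.
    by rewrite !inE => /andP[_ /eqP[-> ->]]; rewrite !eqxx.
  apply: leq_trans (leq_mul (fL a) (fL b)) _.
  apply: leq_trans (leq_mul LMs LMs) _.
  rewrite (_ : 2 * M * s * (2 * M * s) = 4 * M ^ 2 * (s * s)); last by rewrite expnS expn1; nia.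
  rewrite leq_mul2l; apply/orP; right.
  apply: leq_trans (leq_mul sa sb) _.
  rewrite -cardsX; apply/subset_leq_card/subsetP => [[x y]].
  rewrite !inE /= => /andP[xw yw].
  have := subsetP wa x xw; rewrite inE => /eqP fx.
  have := subsetP wb y yw; rewrite inE => /eqP fy.
  by rewrite /ff /= fx fy bab xw yw eqxx.
have : #|silent_triples f'| = #|silent_triples f| + #|silent_triples f' :\: silent_triples f|.
  by rewrite -(cardsID (silent_triples f) (silent_triples f')) (setIidPr mono).
by move=> ->; rewrite mulnDr leq_add2l; apply: leq_trans bad_le _; rewrite leq_mul2l new_le orbT.
Qed.

End Partition.

Lemma joined_partition (Q : finType) (M tau : nat) : 0 < M -> 0 < tau ->
  exists K0, forall (V : finType) (e : Q -> rel V), K0 <= #|V| ->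
  exists k (f : V -> 'I_(2 * k)), [/\ 0 < k, k <= K0 &
    tau * #|bad_vertices e f ((#|V| %/ k).+1 %/ M)| <= #|V| ^ 2].
Proof.
move=> M0 tau0; pose W := 4 * M ^ 2.
(* [R] bounds the number of remaining rounds: a refinement of a partition with too many bad pairs
   raises the scaled potential by at least |V|^2. *)
suff H R k : 0 < k -> exists K0, forall (V : finType) (e : Q -> rel V)
    (f : V -> 'I_(2 * k)), K0 <= #|V| -> (forall a, #|cell f a| <= (#|V| %/ k).+1) ->
    tau * W * (#|Q| * #|V| ^ 2) < tau * W * #|silent_triples e f| + R * #|V| ^ 2 ->
    exists k (f : V -> 'I_(2 * k)), [/\ 0 < k, k <= K0 &
      tau * #|bad_vertices e f ((#|V| %/ k).+1 %/ M)| <= #|V| ^ 2].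
  have [K0 HK] := H (tau * W * #|Q|).+1 1 isT.
  exists K0.+1 => V e KV; have [||| k [f [k0 kK bad]]] := HK V e (fun=> ord0).
  - exact: ltnW.
  - by move=> a; rewrite divn1; apply: leqW; apply: max_card.
  - have : 0 < #|V| ^ 2 by rewrite expn_gt0 (leq_ltn_trans _ KV).
    by nia.
  by exists k, f; split=> //; apply: leqW.
elim: R k => [|R IH] k k0.
  exists 0 => V e f _ _; rewrite addn0 ltnNge leq_mul2l; case/negP.
  apply/orP; right; apply: leq_trans (max_card _) _.
  by rewrite !card_prod mulnn.
have next0 : 0 < next_size k by rewrite !muln_gt0 k0 !expn_gt0.
have [K1 HK1] := IH _ next0.
exists (K1 + k + k * M) => V e f KV fL big.
have [good|bad] := leqP (tau * #|bad_vertices e f ((#|V| %/ k).+1 %/ M)|) (#|V| ^ 2).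
  by exists k, f; split=> //; lia.
have [||//|f' [f'L gain]] := @refine_partition Q V e k M f k0; [by lia|by []|].
have [||k' [g [? ? ?]]] := HK1 V e f' _ f'L; first by lia.
  have := leq_mul (leqnn tau) gain; rewrite -/W; move: big bad; clear.
  by move: #|silent_triples e f| #|silent_triples e f'| (#|V| ^ 2) #|bad_vertices _ _ _|; nia.
by exists k', g; split=> //; lia.
Qed.

(** * Combining the colours *)

Lemma coarsen_labels (V : finType) (U : {set V}) (K : nat) (h : V -> nat) :
  0 < K -> (forall c, #|[set x in U | h x == c]| <= K) ->
  exists h' : V -> nat, [/\ forall x y, h x = h y -> h' x = h' y,
    forall x, h' x <= #|V| %/ K & forall c, #|[set x in U | h' x == c]| <= 2 * K].
Proof.
(* Pieces are merged in the order of their labels: the new label is the number of vertices of [U]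
   with smaller label, divided by [K]. *)
move=> K0 hK; pose P x := [set y in U | h y < h x].
exists (fun x => #|P x| %/ K); split=> [x y hxy|x|c].
- by rewrite /P hxy.
- by apply/leq_div2r/max_card.
set A := [set x in U | _].
have [->|[x0 x0A]] := set_0Vmem A; first by rewrite cards0.
case: (@arg_maxnP _ x0 (mem A) h x0A) => x1 x1A max1.
case: (@arg_minnP _ x0 (mem A) h x0A) => x2 x2A min2.
(* A new class consists of its last old piece and of fewer than [K] vertices preceding that
   piece. *)
have : A \subset [set y in U | h y == h x1] :|: (P x1 :\: P x2).
  apply/subsetP => y yA; move: (max1 y yA) (min2 y yA); move: (yA).
  by rewrite !inE => /andP[-> _] /=; lia.
move/subset_leq_card/leq_trans; apply; apply: leq_trans (leq_card_setU _ _) _.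
rewrite mul2n -addnn; apply: leq_add; first exact: hK.
have sub : P x2 \subset P x1.
  apply/subsetP => y; rewrite !inE => /andP[-> /= yx2].
  by apply: leq_trans yx2 (max1 _ x2A).
rewrite cardsD (setIidPr sub).
move: x1A x2A; rewrite !inE => /andP[_ /eqP c1] /andP[_ /eqP c2].
have := divn_eq #|P x1| K; have := divn_eq #|P x2| K; rewrite c1 c2.
by have := ltn_pmod #|P x1| K0; lia.
Qed.

Lemma card_pairs_ge (V : finType) (A : {set V}) (B : {set V * V}) (k : nat) :
  (forall x, x \in A -> #|A| <= #|[set y in A | (x, y) \in B]| + k) ->
  #|A| * (#|A| - k) <= #|B|.
Proof.
move=> H; rewrite (card_fibers fst) -sum_nat_const big_mkcond /=.
apply: leq_sum => x _; case: ifP => // xA; have := H x xA.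
rewrite addnC -leq_subLR => /leq_trans; apply.
rewrite -(card_imset _ (f := fun y => (x, y))) => [|y z [] //].
apply/subset_leq_card/subsetP => _ /imsetP[y + ->].
by rewrite !inE eqxx andbT => /andP[].
Qed.

Lemma iterated_shattering (r : nat) (V I : finType) (e : 'I_r -> rel V)
    (f : V -> I) (s d K : nat) (m : 'I_r -> nat) :
  (forall i, symmetric (e i)) -> 0 < s -> (forall i, 0 < m i) -> ~~ odd d ->
  s <= 2 ^ d -> 2 ^ d < 4 * s -> 2 * #|I| <= d ->
  (forall i, m i + 2 * (#|I| * (60 * s)) <= K) ->
  (forall i (p : seq V), uniq p -> size p = m i + 2 * d.+1 -> ~~ cycle (e i) p) ->
  exists U : {set V}, #|V| <= 2 ^ r * (#|U| + #|I| * (60 * s)) /\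
    forall i, shattered (joined_edge (e i) f s) K U.
Proof.
move=> es s0 m0 d_even sd ds Id mK no_cycle; set slack := #|I| * (60 * s).
(* With the slack added on both sides, each colour costs exactly a factor 2. *)
suff H j : j <= r -> exists U : {set V}, #|V| + slack <= 2 ^ j * (#|U| + slack) /\
    forall i : 'I_r, i < j -> shattered (joined_edge (e i) f s) K U.
  have [U [cU sU]] := H r (leqnn r); exists U; split=> [|i]; last exact: sU.
  by apply: leq_trans cU; apply: leq_addr.
elim: j => [_|j IH jr].
  by exists setT; rewrite mul1n cardsT.
have [U [cU sU]] := IH (ltnW jr); pose i := Ordinal jr.
have [U' [U'U cU' sU']] := large_shattered_subset f U (es i) s0 (m0 i)
  d_even sd ds Id (mK i) (no_cycle i).
exists U'; split; first by rewrite -/slack in cU'; rewrite expnS; nia.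
move=> i'; rewrite ltnS leq_eqVlt => /predU1P[E|/sU]; last exact: shatteredS.
by have -> : i' = i by apply: val_inj.
Qed.

(** The smallest power of two that is at least s is below 2s; if its exponent is odd, it is
    doubled. *)
Lemma even_exponent (s : nat) : 1 < s ->
  exists d, [/\ ~~ odd d, s <= 2 ^ d & 2 ^ d < 4 * s].
Proof.
move=> s1; have := up_log_bounds (isT : 1 < 2) s1; set l := up_log 2 s => /andP[lo hi].
have l0 : 0 < l by rewrite up_log_gt0.
exists (l + odd l); split; first by rewrite oddD oddb addbb.
  by apply: leq_trans hi _; rewrite leq_pexp2l ?leq_addr.
rewrite -[l]prednK // in lo *; move: (odd _); rewrite /= in lo.
by case; rewrite ?addn1 ?addn0 !expnS; lia.
Qed.

(** With Q = 16rw, the product Q u is at least (16r - 1) n, while Q r (2K) is at most 6rn. *)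
Lemma many_free_pairs (r w n u c K : nat) :
  0 < r -> 0 < n -> n <= w * (u + c) -> 16 * r * w * c <= n ->
  16 * r * w * K <= 3 * n ->
  n ^ 2 < (16 * r * w) ^ 2 * (u * (u - r * (2 * K))).
Proof.
move=> r0 n0 nu; set Q := 16 * r * w => Qc QK.
have h1 : 16 * r * n <= Q * u + n.
  apply: leq_trans (leq_add (leqnn _) Qc).
  have -> : Q * u + Q * c = 16 * r * (w * (u + c)) by rewrite -mulnDr /Q !mulnA.
  by rewrite leq_mul2l nu orbT.
have h2 : 2 * n <= Q * u.
  have : n <= r * n by rewrite leq_pmull.
  by rewrite -mulnA in h1; lia.
have h3 : n <= Q * (u - r * (2 * K)).
  rewrite mulnBr.
  have -> : Q * (r * (2 * K)) = 2 * r * (Q * K) by rewrite [LHS]mulnCA; lia.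
  have : 2 * r * (Q * K) <= 6 * (r * n) by have := leq_mul (leqnn (2 * r)) QK; lia.
  have : n <= r * n by rewrite leq_pmull.
  by rewrite -mulnA in h1; lia.
rewrite -mulnn -[Q ^ 2]mulnn mulnACA; apply: leq_trans (leq_mul h2 h3).
by rewrite ltn_pmul2r //; lia.
Qed.

(** Each colour has its own length [t i]. This suits a family of cycles: a colouring that fails
    supplies a missing length for every colour. *)
Lemma monochromatic_cycle (r : nat) : 0 < r ->
  exists E n0, forall (V : finType) (e : 'I_r -> rel V) (t : 'I_r -> nat),
    n0 <= #|V| -> (forall i, symmetric (e i)) ->
    (forall X Y : {set V}, [disjoint X & Y] -> #|V| <= E * #|X| -> #|V| <= E * #|Y| ->
       exists i x y, [/\ x \in X, y \in Y & e i x y]) ->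
    (forall i d, 2 ^ d <= 4 * #|V| -> 2 * d + 3 <= t i) ->
    (forall i, t i * (r * 2 ^ (r + 4)) <= #|V|) ->
    exists i p, [/\ uniq p, size p = t i & cycle (e i) p].
Proof.
move=> r0; set Q := r * 2 ^ (r + 4).
have Q0 : 0 < Q by rewrite muln_gt0 r0 expn_gt0.
(* [B] bounds the labels per colour after coarsening. [M] makes s so small that the slack and the
   vertices in small pieces amount to at most n / Q. *)
pose B := (2 * Q).+1; pose M := 4 * Q * (60 + B ^ r).
have M0 : 0 < M by rewrite muln_gt0 muln_gt0 Q0.
have QQ0 : 0 < Q * Q by rewrite muln_gt0 Q0.
have [K0 part] := joined_partition 'I_r M0 QQ0.
(* [E] is chosen for n <= E s. The last summand of the threshold forces s >= 2 ^ (4 K0 + 4), so that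
   the depth d is at least 2 #|I|. *)
pose E := 2 * K0 * M; exists E, (K0 + K0 * M + Q + E * 2 ^ (4 * K0 + 4)).
move=> V e t; set n := #|V| => nbig es joinG t_low t_high.
have [|k [f [k0 kK0 bad]]] := part V e; first by rewrite -/n; lia.
rewrite -/n in bad; set L := (n %/ k).+1 in bad; set s := L %/ M in bad.
have E0 : 0 < E by rewrite muln_gt0 M0 muln_gt0 (leq_trans k0 kK0).
have nE : n <= E * s.
  have nL : n < k * L by rewrite mulnC -ltn_divLR.
  have ML : M <= L.
    apply: leqW; rewrite leq_divRL //; have := leq_mul kK0 (leqnn M); lia.
  have s_gt0 : 0 < s by rewrite divn_gt0.
  have LMs : L <= 2 * M * s.
    by have := divn_eq L M; rewrite -/s; have := ltn_pmod L M0; nia.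
  apply: leq_trans (ltnW nL) _; apply: leq_trans (leq_mul kK0 LMs) _.
  by rewrite /E; lia.
have s_big : 2 ^ (4 * K0 + 4) <= s.
  rewrite -(leq_pmul2l E0); apply: leq_trans nE; apply: leq_trans nbig.
  exact: leq_addl.
have s1 : 1 < s.
  by apply: leq_trans s_big; rewrite -[2]/(2 ^ 1) leq_exp2l //; lia.
have s0 := ltnW s1.
have [d [d_even sd ds]] := even_exponent s1.
pose I : finType := 'I_(2 * k).
have Id : 2 * #|I| <= d.
  rewrite card_ord; have : 4 * K0 + 4 <= d.
    by rewrite -(@leq_exp2l 2) //; apply: leq_trans s_big sd.
  by lia.
have kn : k <= n by apply: leq_trans kK0 (leq_trans _ nbig); rewrite -!addnA leq_addr.
have sn : M * s * k <= 2 * n.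
  have Ms : M * s <= L by rewrite mulnC leq_divM.
  apply: leq_trans (leq_mul Ms (leqnn k)) _.
  by rewrite mul2n -addnn /L mulSn leq_add ?leq_divM.
have ns : s <= n.
  rewrite -(leq_pmul2l (isT : 0 < 2)); apply: leq_trans sn.
  rewrite -mulnA leq_mul //; last by rewrite leq_pmulr.
  apply: (@leq_trans (4 * Q)); first by lia.
  by apply: leq_pmulr; rewrite addn_gt0.
have td i : 2 * d + 3 <= t i.
  by apply: t_low; apply: leq_trans (ltnW ds) _; rewrite leq_mul2l ns.
pose slack := #|I| * (60 * s).
pose K := n %/ Q + 2 * slack.
have tK i : t i <= n %/ Q by rewrite leq_divRL //; apply: t_high.
pose m i := t i - 2 * d.+1.
have mt i : m i + 2 * d.+1 = t i by rewrite subnK //; have := td i; lia.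
have Qn : Q <= n by apply: leq_trans nbig; rewrite -addnA addnCA leq_addr.
have nQ0 : 0 < n %/ Q by rewrite divn_gt0.
have Kpos : 0 < K by rewrite addn_gt0 nQ0.
have [/existsP[i /existsP[p /andP[up cp]]]|none] :=
    boolP [exists i, exists p : (t i).-tuple V, uniq p && cycle (e i) p].
  by exists i, p; rewrite size_tuple.
exfalso.
have no_cycle i (p : seq V) : uniq p -> size p = m i + 2 * d.+1 -> ~~ cycle (e i) p.
  rewrite mt => up sp; apply: contra none => cp; apply/existsP; exists i.
  by apply/existsP; exists (Tuple (introT eqP sp)); rewrite up.
have [||U [cU sU]] := @iterated_shattering r V I e f s d K m es s0 _ d_even sd ds Id _ no_cycle.
- by move=> i; have := mt i; have := td i; lia.
- by move=> i; rewrite leq_add2r; apply: leq_trans (tK i); rewrite -(mt i) leq_addr.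
have [h hP] : exists h : 'I_r -> V -> nat, forall i,
    [/\ {in U &, forall x y, joined_edge (e i) f s x y -> h i x = h i y},
        forall x, h i x < B & forall c, #|[set x in U | h i x == c]| <= 2 * K].
  apply: (@fin_all_exists _ (fun=> V -> nat) (fun i h =>
    [/\ {in U &, forall x y, joined_edge (e i) f s x y -> h x = h y},
        forall x, h x < B & forall c, #|[set x in U | h x == c]| <= 2 * K])) => i.
  have [h0 [h0G h0K]] := sU i.
  have [h [hh hB hK]] := coarsen_labels Kpos h0K; exists h; split=> // [x y xU yU Gxy|x].
    exact/hh/h0G.
  rewrite ltnS; apply: leq_trans (hB x) _.
  apply: (@leq_trans (n %/ (n %/ Q))); first by apply: leq_div2l; rewrite ?leq_addr.
  rewrite -[leqRHS](mulnK _ nQ0); apply/leq_div2r/(leq_trans (ltnW (ltn_ceil n Q0))).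
  by rewrite mulnC -mulnA mulnCA leq_mul2l; lia.
(* Equal labels mean the same cell and, in every colour, the same coarsened piece. *)
pose lab x : I * {ffun 'I_r -> 'I_B} := (f x, [ffun i => inord (h i x)]).
have labh x y i : lab x = lab y -> h i x = h i y.
  have [_ hB _] := hP i.
  by case=> _ /ffunP/(_ i); rewrite !ffunE => /(congr1 val) /=; rewrite !inordK.
pose piece x := [set y in U | lab y == lab x].
pose Up := [set x in U | s <= #|piece x|].
have cJ : #|{: I * {ffun 'I_r -> 'I_B}}| = 2 * k * B ^ r.
  by rewrite card_prod card_ffun !card_ord.
have cUp : #|U| <= #|Up| + 2 * k * B ^ r * s.
  rewrite -(cardsID Up U); apply: leq_add; first exact/subset_leq_card/subsetIr.
  rewrite (card_fibers lab) -cJ -sum_nat_const; apply: leq_sum => j _.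
  have [->|[x]] := set_0Vmem [set x in U :\: Up | lab x == j]; first by rewrite cards0.
  rewrite !inE => /andP[/andP[xUp xU] /eqP <-]; rewrite xU -ltnNge in xUp.
  apply: leq_trans (ltnW xUp); apply/subset_leq_card/subsetP => y.
  by rewrite !inE => /andP[/andP[_ ->]].
pose free := [set p : V * V | [&& p.1 \in Up, p.2 \in Up & [forall i, h i p.1 != h i p.2]]].
have cfree : #|Up| * (#|Up| - r * (2 * K)) <= #|free|.
  apply: card_pairs_ge => x xUp.
  rewrite -(cardsID [set y | (x, y) \in free] Up); apply: leq_add.
    by apply/subset_leq_card/subsetP => y; rewrite !inE.
  have : Up :\: [set y | (x, y) \in free] \subset \bigcup_i [set y in U | h i y == h i x].
    apply/subsetP => y; rewrite in_setD inE => /andP[nf yUp].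
    move: nf; rewrite inE /= xUp yUp /= => /forallPn[i]; rewrite negbK => /eqP hxy.
    apply/bigcupP; exists i => //; rewrite inE hxy eqxx andbT.
    by move: yUp; rewrite inE => /andP[].
  move/subset_leq_card/leq_trans; apply; rewrite -[r in r * _]card_ord.
  by apply: leq_card_bigcup => i; have [_ _] := hP i.
(* Pairs separated in all colours outnumber the at most n^2 / Q^2 bad ones; the contradiction is
   that each of them would be bad. *)
have : #|bad_vertices e f s| < #|free|.
  have QE : Q = 16 * r * 2 ^ r by rewrite /Q expnD; lia.
  have small : 16 * r * 2 ^ r * (slack + 2 * k * B ^ r * s) <= n.
    have -> : slack + 2 * k * B ^ r * s = 2 * (s * k) * (60 + B ^ r).
      by rewrite /slack card_ord; lia.
    rewrite -QE -(leq_pmul2l (isT : 0 < 2)); apply: leq_trans sn.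
    by rewrite /M; lia.
  have slack_n : 16 * r * 2 ^ r * slack <= n.
    by apply: leq_trans small; rewrite leq_mul2l leq_addr orbT.
  have Kn : 16 * r * 2 ^ r * K <= 3 * n.
    rewrite -QE /K mulnDr [3 * n]mulSn leq_add //; first by rewrite mulnC leq_divM.
    by rewrite mulnCA leq_mul2l QE slack_n.
  have Un : n <= 2 ^ r * (#|Up| + (slack + 2 * k * B ^ r * s)).
    by apply: leq_trans cU _; rewrite leq_mul2l addnCA [slack + _]addnC leq_add2r cUp orbT.
  have n0 : 0 < n by apply: leq_trans s0 ns.
  have := many_free_pairs r0 n0 Un small Kn.
  rewrite -QE -[Q ^ 2]mulnn => /(leq_ltn_trans bad).
  rewrite ltn_pmul2l // => /leq_trans; exact.
rewrite ltnNge => /negP; apply; apply/subset_leq_card/subsetP => [[x y]].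
rewrite !inE /= => /and3P[/andP[xU sx] /andP[yU sy] /forallP hxy].
have dxy : [disjoint piece x & piece y].
  rewrite disjoints_subset; apply/subsetP => z; rewrite !inE negb_and => /andP[_ /eqP zx].
  apply/orP; right; apply: contraNneq (hxy (Ordinal r0)) => zy.
  by apply/eqP/labh; rewrite -zx zy.
have nEs z : s <= #|piece z| -> n <= E * #|piece z|.
  by move=> sz; apply: leq_trans nE _; rewrite leq_mul2l sz orbT.
have piece_cell z : piece z \subset cell f (f z).
  by apply/subsetP => u; rewrite !inE => /andP[_ /eqP[-> _]].
(* Colour [i] has an edge here and is not silent. If it were joined, a kept edge would run between
   two pieces with different labels in colour [i]. *)
have [i [u [v [ux vy euv]]]] := joinG _ _ dxy (nEs _ sx) (nEs _ sy).
apply/existsP; exists i; apply/andP; split.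
  apply/negP => /[dup] joinxy /joinedP/(_ _ _ (piece_cell x) (piece_cell y) sx sy).
  case=> u' [v' [u'x v'y euv']]; have [hG _ _] := hP i.
  have := subsetP (piece_cell _) _ u'x; have := subsetP (piece_cell _) _ v'y.
  move: u'x v'y; rewrite !inE => /andP[u'U /eqP u'x] /andP[v'U /eqP v'y] /eqP fv /eqP fu.
  have := hG u' v' u'U v'U; rewrite /joined_edge euv' fu fv joinxy => /(_ isT).
  by rewrite (labh _ _ i u'x) (labh _ _ i v'y); apply/eqP/hxy.
apply/forall_inPn; exists u; first exact: subsetP (piece_cell x) _ ux.
apply/forall_inPn; exists v; first exact: subsetP (piece_cell y) _ vy.
by rewrite negbK.
Qed.

(** * Random graphs *)

(* Imported only here because all_classical shadows finset lemmas used above. *)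
Require Import Defs.
From mathcomp Require Import all_boot all_order all_algebra.
From mathcomp Require Import all_classical all_reals all_analysis.
From mathcomp Require Import ring lra.

Import Order.TTheory GRing.Theory Num.Theory.
Import numFieldNormedType.Exports.

Local Open Scope ring_scope.

Definition joined_graph (E : nat) (G : sgraph) : Prop :=
  forall X Y : {set G}, [disjoint X & Y] ->
  (#|G| <= E * #|X|)%N -> (#|G| <= E * #|Y|)%N ->
  exists x y, [/\ x \in X, y \in Y & adj x y].

Section RandomGraph.

Variables (R : realType) (n : nat) (p : R).
Hypothesis p01 : 0 <= p <= 1.

Lemma gnp_weight_ge0 (E : {set {set 'I_n}}) : 0 <= gnp_weight p E.
Proof.
case/andP: p01 => p0 p1; apply: prodr_ge0 => e _.
by case: ifP => _ //; rewrite subr_ge0.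
Qed.

Lemma gnp_prob_mono (P Q : sgraph -> Prop) :
  (forall E, P (@graph_of_edges n E) -> Q (@graph_of_edges n E)) ->
  gnp_prob n p P <= gnp_prob n p Q.
Proof.
move=> PQ; rewrite /gnp_prob [leRHS](bigID (fun E => `[< P (graph_of_edges E) >])) /=.
rewrite [X in _ <= X + _](eq_bigl
    (fun E => (E \in powerset (pairs n)) && `[< P (graph_of_edges E) >])).
  by rewrite lerDl sumr_ge0 // => E _; apply: gnp_weight_ge0.
move=> E; rewrite -andbA; congr (_ && _); apply/andP/idP => [[]//|h].
by split=> //; apply/asboolP/PQ/asboolP.
Qed.

(** Expanding the product of the factors p + (1 - p), with p deleted on [F], gives the sum over the
    edge sets that avoid [F]. *)
Lemma gnp_prob_avoid (F : {set {set 'I_n}}) : F \subset pairs n ->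
  \sum_(E in powerset (pairs n) | [disjoint E & F]) gnp_weight p E = (1 - p) ^+ #|F|.
Proof.
move=> Fn; transitivity (\prod_(e : {set 'I_n})
    ((if e \in pairs n :\: F then p else 0) + (if e \in pairs n then 1 - p else 1))).
  rewrite bigA_distr [RHS](bigID (fun E : {set {set 'I_n}} => E \subset pairs n :\: F)) /=.
  rewrite [X in _ = _ + X]big1 ?addr0 => [|E]; last first.
    by move=> /fintype.subsetPn[e eE /negbTE ep]; rewrite (bigD1 e) //= eE ep mul0r.
  apply: eq_big => [E|E]; first by rewrite powersetE subsetD.
  rewrite powersetE => /andP[/fintype.subsetP sE dEF].
  rewrite /gnp_weight big_mkcond; apply: eq_bigr => e _.
  case: ifPn => [en|/negbTE en]; case: ifPn => // eE; last first.
    by have := sE _ eE; rewrite en.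
  by rewrite finset.in_setD en andbT ifT //; apply: contraTN eE => /(disjointFl dEF)->.
rewrite -prodr_const [RHS]big_mkcond /=; apply: eq_bigr => e _; rewrite finset.in_setD.
have [eF|_] := boolP (e \in F); first by rewrite (fintype.subsetP Fn) // add0r.
by case: (e \in pairs n) => /=; rewrite ?add0r // addrCA subrr addr0.
Qed.

Definition crossing_pairs (X Y : {set 'I_n}) : {set {set 'I_n}} :=
  [set [set q.1; q.2] | q in finset.setX X Y]%SET.

Lemma crossing_pairsP (X Y : {set 'I_n}) : [disjoint X & Y] ->
  crossing_pairs X Y \subset pairs n /\ #|crossing_pairs X Y| = (#|X| * #|Y|)%N.
Proof.
move=> XY; have neq x y : x \in X -> y \in Y -> x != y.
  by move=> xX yY; apply: contraTneq yY => <-; rewrite (disjointFr XY).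
split.
  apply/fintype.subsetP => _ /imsetP[[x y] + ->]; rewrite !inE /= => /andP[xX yY].
  by rewrite cards2 neq.
rewrite -cardsX; apply: card_in_imset => [[x y] [x' y']].
rewrite !inE /= => /andP[xX yY] /andP[xX' yY'] E.
have : x \in [set x'; y']%SET by rewrite -E !inE eqxx.
rewrite !inE (negbTE (neq _ _ xX yY')) orbF => /eqP xx.
have : y \in [set x'; y']%SET by rewrite -E !inE eqxx orbT.
by rewrite !inE eq_sym (negbTE (neq _ _ xX' yY)) /= xx => /eqP->.
Qed.

(** Union bound over the 4^n pairs of sets. A large disjoint pair has no crossing edge with
    probability at most exp(- p |X| |Y|) <= exp(- 3n) <= 8^(- n). *)
Lemma gnp_joined (E : nat) : (0 < n)%N -> (3 * E.+1 ^ 2)%:R / n%:R <= p ->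
  1 - (1 / 2) ^+ n <= gnp_prob n p (joined_graph E).
Proof.
move=> n0 pC; case/andP: (p01) => p0 p1.
pose J (q : {set 'I_n} * {set 'I_n}) :=
  [&& [disjoint q.1 & q.2], (n <= E * #|q.1|)%N & (n <= E * #|q.2|)%N].
have split1 : 1 <= gnp_prob n p (joined_graph E) +
    \sum_(q | J q) \sum_(D in powerset (pairs n) | [disjoint D & crossing_pairs q.1 q.2])
      gnp_weight p D.
  rewrite -(gnp_probT n p) /gnp_prob.
  rewrite (bigID (fun D => `[< joined_graph E (graph_of_edges D) >])) /=.
  rewrite (eq_bigl (fun D => (D \in powerset (pairs n)) &&
    `[< joined_graph E (graph_of_edges D) >])); last first.
    by move=> D; rewrite (asboolT I) andbT.
  rewrite lerD2l (exchange_big_dep (fun D => D \in powerset (pairs n))) /=; last first.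
    by move=> q D _ /andP[].
  rewrite [leRHS](bigID (fun D => ~~ `[< joined_graph E (graph_of_edges D) >])) /=.
  rewrite -[leLHS]addr0 lerD //; last first.
    by apply: sumr_ge0 => D _; apply: sumr_ge0 => q _; apply: gnp_weight_ge0.
  rewrite [leLHS](eq_bigl (fun D => (D \in powerset (pairs n)) &&
    ~~ `[< joined_graph E (graph_of_edges D) >])); last first.
    by move=> D; rewrite (asboolT I) andbT.
  apply: ler_sum => D /andP[Dn /asboolPn nJ].
  have [q Jq qD] : exists2 q, J q & [disjoint D & crossing_pairs q.1 q.2].
    apply: contrapT => none; apply: nJ => X Y XY; rewrite card_ord => nX nY.
    apply: contrapT => noe; apply: none; exists (X, Y); first by rewrite /J XY nX nY.
    rewrite disjoint_sym; apply/pred0Pn => -[e /andP[/imsetP[[x y] + ->] eD]].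
    rewrite !inE /= => /andP[xX yY]; apply: noe; exists x, y; split=> //.
    have {}eD : [set x; y]%SET \in D := eD.
    by rewrite /= /edges_adj eD andbT; apply: contraTneq yY => <-; rewrite (disjointFr XY).
  rewrite (bigD1 q) /=; last by rewrite Jq Dn qD.
  by rewrite lerDl sumr_ge0 // => q' _; apply: gnp_weight_ge0.
have one q : J q -> \sum_(D in powerset (pairs n) | [disjoint D & crossing_pairs q.1 q.2])
      gnp_weight p D <= (1 / 8) ^+ n.
  case/and3P => dq nX nY; have [sub card] := crossing_pairsP dq.
  rewrite gnp_prob_avoid // card; set k := (#|_| * _)%N.
  have kn : (n ^ 2 <= E.+1 ^ 2 * k)%N.
    rewrite -!mulnn /k mulnACA; apply: leq_mul.
      by apply: leq_trans nX _; rewrite leq_mul2r leqnSn orbT.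
    by apply: leq_trans nY _; rewrite leq_mul2r leqnSn orbT.
  have pk : 3 * n%:R <= p * k%:R.
    have n0' : 0 < n%:R :> R by rewrite ltr0n.
    apply: le_trans (ler_wpM2r (ler0n _ k) pC).
    rewrite mulrAC ler_pdivlMr // -mulrA -!natrM ler_nat mulnn -mulnA leq_mul2l.
    by rewrite kn.
  apply: (@le_trans _ _ (expR (- p) ^+ k)).
    rewrite lerXn2r ?nnegrE ?subr_ge0 ?expR_ge0 //.
    by have := expR_ge1Dx (- p).
  rewrite -expRM_natr.
  apply: (@le_trans _ _ (expR (- 3) ^+ n)).
    by rewrite -expRM_natr ler_expR !mulNr lerN2.
  rewrite lerXn2r ?nnegrE ?expR_ge0 ?divr_ge0 //.
  rewrite expRN -[X in expR X]mulr1 expRM_natl div1r lef_pV2 ?posrE ?exprn_gt0 ?expR_gt0 //.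
  rewrite (_ : 8 = 2 ^+ 3 :> R); last by rewrite -natrX.
  rewrite lerXn2r ?nnegrE ?expR_ge0 //.
  by have := expR_ge1Dx (1 : R); rewrite -[1 + 1]/(2%:R).
have : \sum_(q | J q) \sum_(D in powerset (pairs n) | [disjoint D & crossing_pairs q.1 q.2])
      gnp_weight p D <= (1 / 2) ^+ n.
  apply: (@le_trans _ _ (\sum_(q : {set 'I_n} * {set 'I_n}) (1 / 8) ^+ n)).
    rewrite [leLHS]big_mkcond; apply: ler_sum => q _.
    by case: ifP => [/one//|_]; rewrite exprn_ge0 ?divr_ge0.
  have c2 : #|{: {set 'I_n} * {set 'I_n}}| = (4 ^ n)%N.
    have -> : #|{: {set 'I_n} * {set 'I_n}}| = (#|powerset [set: 'I_n]%SET| ^ 2)%N.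
      rewrite card_prod mulnn; congr (_ ^ 2)%N; apply: eq_card => D.
      by rewrite powersetE finset.subsetT.
    by rewrite card_powerset cardsT card_ord -expnM mulnC expnM.
  by rewrite sumr_const c2 -[leLHS]mulr_natr natrX -exprMn; rewrite (_ : 1 / 8 * 4%:R = 1 / 2 :> R) //; lra.
by move: split1; lra.
Qed.

End RandomGraph.

Local Open Scope classical_set_scope.
Local Open Scope ring_scope.

Lemma whp_joined (R : realType) (E : nat) (p : nat -> R) (P : nat -> sgraph -> Prop) :
  (forall n, 0 <= p n <= 1) ->
  (\forall n \near \oo, (3 * E.+1 ^ 2)%:R / n%:R <= p n) ->
  (\forall n \near \oo, forall D, joined_graph E (@graph_of_edges n D) ->
     P n (graph_of_edges D)) ->
  whp p P.
Proof.
move=> p01 pC JP; apply: (@squeeze_cvgr _ _ _ _ (fun n => 1 - (1 / 2) ^+ n) (fun=> 1)).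
- near=> n; apply/andP; split; last first.
    by rewrite -(gnp_probT n (p n)); apply: gnp_prob_mono.
  apply: (@le_trans _ _ (gnp_prob n (p n) (joined_graph E))).
    apply: gnp_joined => //; last by near: n.
    by near: n; exact: nbhs_infty_gt.
  by apply: gnp_prob_mono => //; near: n.
- rewrite -[X in _ --> X]subr0; apply: cvgB; first exact: cvg_cst.
  by apply: cvg_expr; rewrite ger0_norm; lra.
- exact: cvg_cst.
Unshelve. all: by end_near. Qed.

(** * From the deterministic statement to arrows *)

Lemma cycle_next (T : Type) (e : rel T) (x : T) (p : seq T) (i : nat) :
  cycle e p -> (i < size p)%N -> e (nth x p i) (nth x p (i.+1 %% size p)).
Proof.
case: p => // a p /= /(pathP x) ep ip.
have := ep i; rewrite size_rcons => /(_ ip); rewrite -rcons_cons nth_rcons /= ip.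
move: ip; rewrite ltnS leq_eqVlt => /predU1P[->|ip].
  by rewrite nth_rcons ltnn eqxx modnn.
by rewrite nth_rcons ip modn_small.
Qed.

Lemma mono_copy_cycle (r : nat) (G : sgraph) (c : coloring r G) (i : 'I_r) (p : seq G) :
  (0 < size p)%N -> uniq p ->
  cycle (fun x y => adj x y && (c [set x; y]%SET == i)) p ->
  mono_copy (cycle_graph (size p)) c i.
Proof.
case: p => // a p _ up cp; set t := size (a :: p).
exists (fun k : 'I_t => nth a (a :: p) k); split.
  by move=> k l /eqP; rewrite nth_uniq ?ltn_ord // => /eqP/val_inj.
have step (k : 'I_t) : adj (nth a (a :: p) k) (nth a (a :: p) (ordS k)) /\
    c [set nth a (a :: p) k; nth a (a :: p) (ordS k)]%SET = i.
  by have /andP[? /eqP] := cycle_next a cp (ltn_ord k).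
move=> k l /andP[_ /orP[/eqP->|/eqP->]]; first exact: step.
by rewrite adj_sym finset.setUC; apply: step.
Qed.

Lemma joined_arrow (r : nat) : (0 < r)%N -> exists E n0, forall G : sgraph,
  (n0 <= #|G|)%N -> joined_graph E G -> forall D : set nat,
  (forall t, D t -> (forall d, 2 ^ d <= 4 * #|G| -> 2 * d + 3 <= t)%N /\
     (t * (r * 2 ^ (r + 4)) <= #|G|)%N) ->
  arrow_family r G D cycle_graph.
Proof.
move=> r0; have [E [n0 H]] := monochromatic_cycle r0; exists E, n0.+1 => G nG JG D DP c.
apply: contrapT => none.
(* If every colour fails, each misses some length in [D]. *)
have /choice[t tP] (i : 'I_r) : exists t, D t /\ ~ mono_copy (cycle_graph t) c i.
  apply: contrapT => noi; apply: none; exists i => t Dt.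
  by apply: contrapT => nc; apply: noi; exists t.
pose e i x y := adj x y && (c [set x; y]%SET == i).
have [||||i [p [up sp cp]]] := H G e t (ltnW nG).
- by move=> i x y; rewrite /e adj_sym finset.setUC.
- move=> X Y XY nX nY; have [x [y [xX yY exy]]] := JG X Y XY nX nY.
  by exists (c [set x; y]%SET), x, y; rewrite /e exy eqxx.
- by move=> i; have [/DP[]] := tP i.
- by move=> i; have [/DP[]] := tP i.
have [Dt []] := tP i; rewrite -sp; apply: mono_copy_cycle => //.
(* The case d = 0 gives 3 <= t. *)
by have [/(_ 0%N) tl _] := DP _ Dt; rewrite sp; lia.
Qed.

(** * Estimates for the range of lengths, and the conclusion *)

Lemma log_lower_bound (R : realType) (n t d : nat) : (1 < n)%N ->
  10 / ln 2 * ln n%:R <= t%:R :> R -> (2 ^ d <= 4 * n)%N -> (2 * d + 3 <= t)%N.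
Proof.
move=> n1 nt dn.
have l2 : 0 < ln 2 :> R by rewrite ln_gt0 // ltr1n.
have n0 : 0 < n%:R :> R by rewrite ltr0n ltnW.
have ln2 : ln 2 <= ln n%:R :> R by rewrite ler_ln ?posrE // ler_nat.
have : ln (2 ^+ d) <= ln (2 ^+ 2 * n%:R) :> R.
  by rewrite ler_ln ?posrE ?mulr_gt0 ?exprn_gt0 // -!natrX -natrM ler_nat.
(* Here d ln 2 <= 2 ln 2 + ln n, hence (2d + 3) ln 2 <= 7 ln 2 + 2 ln n <= 9 ln n, and 10
   suffices. *)
rewrite lnM ?posrE ?exprn_gt0 // !lnXn // => dl.
rewrite -(ler_nat R) natrD natrM; apply: le_trans nt.
rewrite mulrAC ler_pdivlMr //; move: dl; rewrite -[ln 2 *+ d]mulr_natr; nra.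
Qed.

Lemma log_le_linear (R : realType) (A c : R) : 0 < A -> 0 < c ->
  \forall n \near \oo, A * ln n%:R + 2 <= c * n%:R.
Proof.
(* With this [d], A ln (d n) is below A d n = c n / 2; the other half of c n absorbs the
   constants. *)
move=> A0 c0; pose d := c / (2 * A).
have d0 : 0 < d by rewrite divr_gt0 ?mulr_gt0.
near=> n.
have n0 : 0 < n%:R :> R by rewrite ltr0n; near: n; exact: nbhs_infty_gt.
have : (2 - A * ln d) * 2 / c <= n%:R by near: n; exact: nbhs_infty_ger.
rewrite ler_pdivrMr // => nc.
have : ln (d * n%:R) < d * n%:R by apply: ln_sublinear; rewrite mulr_gt0.
rewrite lnM ?posrE // -(ltr_pM2l A0) mulrDr.
have -> : A * (d * n%:R) = c * n%:R / 2 by rewrite /d; field; rewrite gt_eqF.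
by lra.
Unshelve. all: by end_near. Qed.

Lemma floor_odd_ge (R : realType) (x : R) : 1 <= x -> x - 2 <= (floor_odd x)%:R.
Proof.
move=> x1; have x0 : 0 <= x by apply: le_trans x1.
have [_ _ maxm] := floor_oddP x1; have /andP[kx xk] := truncn_itv x0.
set k := Num.truncn x in kx xk; rewrite -natr1 in xk.
have [ok|ek] := boolP (odd k).
  have := maxm k ok kx; rewrite -(ler_nat R); lra.
case: k => [|k] in kx xk ek *.
  by apply: le_trans (ler0n _ _); lra.
rewrite -natr1 in kx xk; have := maxm k.
rewrite /= negbK in ek; move/(_ ek); rewrite -(ler_nat R).
by have -> : k%:R <= x by [lra]; move=> /(_ isT); lra.
Qed.

Unset Implicit Arguments.

Theorem corollary7p8 (R : realType) (r : nat) (hr : (2 < r)%N) :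
  exists A : R, 0 < A /\
  forall beta : R, 0 < beta ->
  exists C : R, 0 < C /\
  forall p : nat -> R,
    (forall n, 0 <= p n <= 1) ->
    (\forall n \near \oo, C / n%:R <= p n) ->
    whp p (fun n G =>
      arrow_family r G
        [set t : nat | [/\ A * ln n%:R <= t%:R,
                           t%:R <= (1 / (r * 2 ^ (r + 4))%N%:R - beta) * n%:R
                         & odd t]]
        cycle_graph)
    /\
    (beta < 1 / (r * 2 ^ (r + 4))%N%:R ->
     whp p (fun n G =>
       arrow r G
         (cycle_graph
            (floor_odd ((1 / (r * 2 ^ (r + 4))%N%:R - beta) * n%:R))))).
Proof.
have r0 : (0 < r)%N by apply: leq_trans hr.
have [E [n0 arrowE]] := joined_arrow r0.
have A0 : 0 < 10 / ln 2 :> R by rewrite divr_gt0 ?ln_gt0 ?ltr1n.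
exists (10 / ln 2); split=> // beta beta0.
exists (3 * E.+1 ^ 2)%:R; split=> [|p p01 pC]; first by rewrite ltr0n.
set Q := (r * 2 ^ (r + 4))%N.
have Q0 : 0 < Q%:R :> R by rewrite ltr0n muln_gt0 r0 expn_gt0.
pose D (n : nat) := [set t : nat | [/\ 10 / ln 2 * ln n%:R <= t%:R :> R,
  t%:R <= (1 / Q%:R - beta) * n%:R & odd t]].
have main : \forall n \near \oo, forall X, joined_graph E (@graph_of_edges n X) ->
    arrow_family r (graph_of_edges X) (D n) cycle_graph.
  near=> n => X JX.
  have n1 : (1 < n)%N by near: n; exact: nbhs_infty_gt.
  apply: arrowE => //; rewrite card_ord; first by near: n; exact: nbhs_infty_ge.
  move=> t [tl th _]; split=> [d|]; first exact: log_lower_bound tl.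
  rewrite -(ler_nat R) natrM -ler_pdivlMr //; apply: le_trans th _.
  by rewrite mulrBl mul1r mulrC gerBl mulr_ge0 // ltW.
split; first exact: whp_joined main.
move=> beta_small; have c0 : 0 < 1 / Q%:R - beta by rewrite subr_gt0.
apply: (whp_joined p01 pC); near=> n => X JX c.
set x := (1 / Q%:R - beta) * n%:R.
have x1 : 1 <= x.
  rewrite /x mulrC -ler_pdivrMr //; near: n; exact: nbhs_infty_ger.
have [om mx _] := floor_oddP x1.
(* The odd floor of x is at least x - 2, hence above A ln n for large n, and so belongs to the range
   [D n]. *)
have /(_ X JX c)[i iP] : forall Y, joined_graph E (@graph_of_edges n Y) ->
    arrow_family r (graph_of_edges Y) (D n) cycle_graph by near: n.
exists i; apply: iP; split=> //; have := floor_odd_ge x1.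
suff : 10 / ln 2 * ln n%:R + 2 <= x by lra.
by rewrite /x; near: n; apply: log_le_linear.
Unshelve. all: by end_near. Qed.
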